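(* Let $\sigma$ be a bicolored subdivision of type $(k,n)$ and $\Gamma_\sigma$ the corresponding tile of $\Delta_{k+1,n}$. Then $\Gamma_\sigma=\bigcup \Delta_{(w)}$, where the union is over all $w\in D_{k+1,n}$ such that: (i) for every white polygon of $\sigma$ with vertices $v_1,\dots,v_r$ in clockwise order, $v_1,\dots,v_r$ appear in this order in $(w)$; and (ii) for every black polygon of $\sigma$ with vertices $v_1,\dots,v_r$ in counterclockwise order, $v_1,\dots,v_r$ appear in this order in $(w)$.
   Context: Notation: $x_S=\sum_{i\in S}x_i$; $[i,j]=\{i,i+1,\dots,j\}$ cyclically mod $n$; $e_I=\sum_{i\in I}e_i$; $\Delta_{k+1,n}=\mathrm{conv}\{e_I: |I|=k+1\}$. Let $\mathbf P_n$ be a convex $n$-gon with vertices $1,\dots,n$ clockwise. A bicolored subdivision $\sigma$ is a partition of $\mathbf P_n$ into polygons (vertices among those of $\mathbf P_n$) colored black or white, polygons sharing an edge having different colors; type $(k,n)$ means any triangulation of its black polygons has $k$ triangles. An arc $i\to j$ is compatible with $\sigma$ if the chord $(i,j)$ is an edge of or lies inside a polygon of $\sigma$; the region left of $i\to j$ is the side of the chord containing vertices $i+1,\dots,j-1$; $\mathrm{area}(i\to j)$ is the number of black triangles to its left in any triangulation of the black polygons. $\Gamma_\sigma=\{x\in\mathbb R^n: x_{[n]}=k+1,\ \mathrm{area}(i\to j)\le x_{[i,j-1]}\le\mathrm{area}(i\to j)+1$ for all compatible $i\to j\}$. For $w=w_1\cdots w_n\in S_n$, $i\in[n]$ is a cyclic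 descent of $w$ if either $i<n$ and $i$ occurs to the right of $i+1$ in $w$, or $i=n$ and $1$ occurs to the left of $n$ in $w$; $\mathrm{cdes}(w)$ is the set of cyclic descents. $D_n=\{w\in S_n: w_n=n\}$ and $D_{k+1,n}$ is the set of $w\in D_n$ with exactly $k+1$ cyclic descents. For $a\in[n]$, $w^{(a)}$ is the cyclic rotation of the word $w$ that ends with $a$, and $I_a=\mathrm{cdes}(w^{(a)})$. The $w$-simplex is $\Delta_{(w)}=\mathrm{conv}(e_{I_1},\dots,e_{I_n})$. $(w)$ denotes the cyclic arrangement $w_1,w_2,\dots,w_n$ placed clockwise on a circle (the $n$-cycle $w_1\mapsto w_2\mapsto\cdots\mapsto w_n\mapsto w_1$); ''$v_1,\dots,v_r$ appear in order in $(w)$'' means that going around this circle starting at $v_1$ one meets $v_1,\dots,v_r$ in that order. *)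

(* Defs.v *)
From HB Require Import structures.
From mathcomp Require Import all_boot all_order all_fingroup all_algebra.
From mathcomp Require Import classical_sets reals.

Set Implicit Arguments.
Unset Strict Implicit.
Unset Printing Implicit Defensive.

Import Order.TTheory GRing.Theory Num.Theory.

Local Open Scope ring_scope.

(* The vertices 1, ..., n of the convex n-gon, listed clockwise, are the
   elements 0, ..., n-1 of 'I_n. A polygon with vertices among them is convex,
   so it is identified with its vertex set, a Q : {set 'I_n} with at least three
   elements; its clockwise vertex order is the increasing order [enum Q]. *)

(* Number of clockwise steps from i to j. *)
Definition cstep n (i j : 'I_n) : nat := (j + n - i) %% n.

(* The cyclic interval [i, j] = {i, i+1, ..., j}. For i != j it is also the set
   of vertices of the n-gon lying on or to the left of the arc i -> j. *)
Definition cint n (i j : 'I_n) : {set 'I_n} :=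
  [set l | (cstep i l <= cstep i j)%N]%SET.

(* The chord (i, j) joins two consecutive vertices of Q. *)
Definition is_edge n (Q : {set 'I_n}) (i j : 'I_n) : bool :=
  [&& i != j, i \in Q, j \in Q &
      (Q :&: cint i j == [set i; j]) || (Q :&: cint j i == [set i; j])]%SET.

(* [subdivision S P]: P is a partition of the polygon S into polygons with
   vertices in S. As S is convex, these are the families obtained by cutting
   S successively along chords (i, j); the chord (i, j) cuts a polygon Q
   having it as a diagonal into Q :&: [i, j] and Q :&: [j, i]. *)
Inductive subdivision n (S : {set 'I_n}) : {set {set 'I_n}} -> Prop :=
| subdivision_trivial : (3 <= #|S|)%N -> subdivision S [set S]%SET
| subdivision_cut (P : {set {set 'I_n}}) (Q : {set 'I_n}) (i j : 'I_n) :
    subdivision S P -> Q \in P ->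
    i \in Q -> j \in Q -> i != j -> ~~ is_edge Q i j ->
    subdivision S ((P :\ Q) :|: [set Q :&: cint i j; Q :&: cint j i])%SET.

Definition triangulation n (S : {set 'I_n}) (T : {set {set 'I_n}}) : Prop :=
  subdivision S T /\ (forall t, t \in T -> #|t| = 3%N).

Record bicolored_subdivision (n : nat) := BicoloredSubdivision {
  black : {set {set 'I_n}};
  white : {set {set 'I_n}};
  black_white_disjoint : [disjoint black & white];
  black_white_subdivision : subdivision [set: 'I_n]%SET (black :|: white)%SET;
  black_white_adjacent : forall (Q Q' : {set 'I_n}) (i j : 'I_n),
    Q \in (black :|: white)%SET -> Q' \in (black :|: white)%SET -> Q != Q' ->
    is_edge Q i j -> is_edge Q' i j -> (Q \in black) != (Q' \in black)
}.

(* T is the set of all triangles of a triangulation of the black polygons. *)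
Definition black_triangulation n (sigma : bicolored_subdivision n)
    (T : {set {set 'I_n}}) : Prop :=
  exists2 tau : {set 'I_n} -> {set {set 'I_n}},
    (forall B, B \in black sigma -> triangulation B (tau B)) &
    T = (\bigcup_(B in black sigma) tau B)%SET.

Definition has_type n (sigma : bicolored_subdivision n) (k : nat) : Prop :=
  forall T, black_triangulation sigma T -> #|T| = k.

Definition compatible n (sigma : bicolored_subdivision n) (i j : 'I_n) : Prop :=
  i != j /\
  exists2 Q, Q \in (black sigma :|: white sigma)%SET & (i \in Q) && (j \in Q).

(* No triangle of T has points strictly on both sides of the chord (i, j). *)
Definition uncrossed n (T : {set {set 'I_n}}) (i j : 'I_n) : Prop :=
  forall t, t \in T -> (t \subset cint i j) || (t \subset cint j i).

(* [has_area sigma i j a]: area(i -> j) = a. When (i, j) is a diagonal of a black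
   polygon, the triangulations to be counted are those with (i, j) among
   their edges; in the others some triangles straddle the arc. *)
Definition has_area n (sigma : bicolored_subdivision n) (i j : 'I_n) (a : nat) :
    Prop :=
  forall T, black_triangulation sigma T -> uncrossed T i j ->
    #|[set t in T | t \subset cint i j]%SET| = a.

Definition Gamma (R : realType) n (sigma : bicolored_subdivision n) (k : nat) :
    set 'rV[R]_n :=
  [set x : 'rV[R]_n | \sum_(i < n) x ord0 i = k.+1%:R /\
    forall (i j : 'I_n) (a : nat), compatible sigma i j -> has_area sigma i j a ->
      a%:R <= \sum_(l in cint i (ord_pred j)) x ord0 l <= a%:R + 1]%classic.
Arguments Gamma R {n} sigma k.

Definition word n (w : 'S_n) : seq 'I_n := [seq w i | i <- enum 'I_n].

(* As [ordS] wraps around, this also covers the case of the largest letter. *)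
Definition cdes n (s : seq 'I_n) : {set 'I_n} :=
  [set i | (index (ordS i) s < index i s)%N]%SET.

(* The cyclic rotation of s ending with a. *)
Definition rot_end n (s : seq 'I_n) (a : 'I_n) : seq 'I_n :=
  rot (index a s).+1 s.

(* The set D_{m,n}. *)
Definition Dset (m n : nat) (w : 'S_n) : Prop :=
  (forall i : 'I_n, i.+1 = n :> nat -> w i = i) /\ #|cdes (word w)| = m.

Definition evec (R : realType) n (I : {set 'I_n}) : 'rV[R]_n :=
  \row_i (i \in I)%:R.

Definition wsimplex (R : realType) n (w : 'S_n) : set 'rV[R]_n :=
  [set x : 'rV[R]_n | exists c : 'I_n -> R,
    [/\ forall a, 0 <= c a, \sum_a c a = 1 &
        x = \sum_a c a *: evec R (cdes (rot_end (word w) a))]]%classic.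
Arguments wsimplex R {n} w.

(* The entries of v appear in this order in the cyclic arrangement (w): they do
   so in the word read around the circle from the first entry of v. *)
Definition in_cyclic_order n (v : seq 'I_n) (w : 'S_n) : bool :=
  if v is v1 :: _ then subseq v (rot (index v1 (word w)) (word w)) else true.

(* Main.v *)
Require Import Defs.
From mathcomp Require Import all_boot all_order all_fingroup all_algebra.
From mathcomp Require Import boolp zify.

(** Place n points p_0, ..., p_{n-1} on a circle of length 1 with p_{i+1} at
    clockwise distance x_i from p_i. Then x lies in the simplex of (w) iff the
    points occur weakly in the cyclic order (w), the barycentric coordinates
    being the gaps, and x_{[i,j-1]} is the distance from p_i to p_j plus a number
    of full turns that depends only on w. For i < l < j that number for i -> j
    exceeds the sum of those for i -> l and l -> j by 1 if (i, l, j) is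
    counterclockwise in (w) and by 0 otherwise; area(i -> j) obeys the same rule
    in a polygon of sigma, with 1 if it is black and 0 if it is white. So the
    conditions on (w) amount to "full turns = area" on the compatible arcs, which
    puts the simplex inside the tile. Conversely, a point x of the tile determines
    (w) up to ties, and the ties are broken in favour of an interior point of the
    tile, obtained by gluing cyclic words along the chords of sigma. *)

Set Implicit Arguments.
Unset Strict Implicit.
Unset Printing Implicit Defensive.

(** * Chords and subdivisions *)

Section CyclicIntervals.
Variable n : nat.
Implicit Types (i j l a b : 'I_n) (Q S : {set 'I_n}).

(** Removes the modular arithmetic, so that configurations of chords reduce to linear inequalities
    for [lia]; the second branch is the interval that wraps around past n-1. *)
Lemma in_cint i j l :
  (l \in cint i j) =
    if i <= j then (i <= l) && (l <= j) else (i <= l) || (l <= j).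
Proof.
rewrite inE /cstep.
have step (u v : 'I_n) : (v + n - u) %% n = if u <= v then v - u else v + n - u.
  have := ltn_ord u; have := ltn_ord v; case: ifP => uv hv hu.
    by rewrite -addnBAC // modnDr modn_small; lia.
  by rewrite modn_small; lia.
have := ltn_ord i; have := ltn_ord j; have := ltn_ord l.
by rewrite !step; do ![case: ifP]; lia.
Qed.

Ltac cint_lia :=
  rewrite ?in_cint;
  repeat match goal with |- context [if ?b then _ else _] => case: (boolP b) end;
  lia.

Lemma cint_l i j : i \in cint i j. Proof. cint_lia. Qed.

Lemma cint_r i j : j \in cint i j. Proof. cint_lia. Qed.

Lemma cint_cover i j l : i != j -> (l \in cint i j) || (l \in cint j i).
Proof. rewrite -val_eqE /=; cint_lia. Qed.

Lemma cintU i j : i != j -> cint i j :|: cint j i = [set: 'I_n].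
Proof. by move=> ij; apply/setP=> l; rewrite in_setU in_setT cint_cover. Qed.

Lemma cintI i j : cint i j :&: cint j i = [set i; j].
Proof.
apply/setP=> l; rewrite in_setI in_set2 -!val_eqE /=; cint_lia.
Qed.

Lemma cint_antisym i j l :
  l \in cint i j -> l \in cint j i -> (l == i) || (l == j).
Proof. by move=> h1 h2; rewrite -in_set2 -cintI in_setI h1 h2. Qed.

Lemma cint_nested a b i j : i != j -> i \in cint a b -> j \in cint a b ->
  (cint b a \subset cint i j) || (cint b a \subset cint j i).
Proof.
rewrite -val_eqE /= => ij hi hj;
  case: (boolP (cint b a \subset cint i j)) => //= /subsetPn[l hl nl].
apply/subsetP=> l'; move: ij hi hj hl nl; cint_lia.
Qed.

Lemma cint_cross a b i j : a != b ->
    ~~ ((i \in cint a b) && (j \in cint a b)) ->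
    ~~ ((i \in cint b a) && (j \in cint b a)) ->
  [/\ a != i, a != j, b != i & b != j] /\
  ((a \in cint i j) && (b \in cint j i) || (b \in cint i j) && (a \in cint j i)).
Proof.
rewrite -val_eqE /= => ab h1 h2.
by split; first split; rewrite -?val_eqE /=; move: ab h1 h2; cint_lia.
Qed.

Lemma cint_between a b i j l : i \in cint a b -> j \in cint a b ->
  l \in cint i j -> l \notin cint a b -> (a \in cint i j) /\ (b \in cint i j).
Proof. by move=> h1 h2 h3 h4; split; move: h1 h2 h3 h4; cint_lia. Qed.

End CyclicIntervals.

(** * Subdivisions: non-crossing chords and triangle counts *)

Section Subdivisions.
Variable n : nat.
Implicit Types (i j l a b : 'I_n) (Q S : {set 'I_n}) (P : {set {set 'I_n}}).

Lemma card_cut Q a b : a \in Q -> b \in Q -> a != b ->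
  #|Q :&: cint a b| + #|Q :&: cint b a| = #|Q| + 2.
Proof.
move=> aQ bQ ab; rewrite -cardsUI -setIUr cintU // setIT setIACA setIid cintI.
by rewrite (setIidPr _) ?cards2 ?ab // subUset !sub1set aQ.
Qed.

Lemma card_cut_ge2 Q a b : a \in Q -> b \in Q -> a != b ->
  1 < #|Q :&: cint a b|.
Proof.
move=> aQ bQ ab; apply: (@leq_trans #|[set a; b]|); first by rewrite cards2 ab.
by rewrite subset_leq_card // subUset !sub1set !in_setI aQ bQ cint_l cint_r.
Qed.

Lemma card_cut_ge3 Q a b : a \in Q -> b \in Q -> a != b -> ~~ is_edge Q a b ->
  2 < #|Q :&: cint a b| /\ 2 < #|Q :&: cint b a|.
Proof.
move=> aQ bQ ab; rewrite /is_edge ab aQ bQ /= negb_or => /andP[n1 n2].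
have sub (c d : 'I_n) : c \in Q -> d \in Q -> [set c; d] \subset Q :&: cint c d.
  by move=> cQ dQ; rewrite subUset !sub1set !in_setI cQ dQ cint_l cint_r.
have card2 : #|[set a; b]| = 2 by rewrite cards2 ab.
split; rewrite -card2; apply: proper_card; rewrite properEneq eq_sym.
  by rewrite n1 sub.
by rewrite n2 /= (setUC [set a]) sub.
Qed.

Lemma subdivision_card3 S P : subdivision S P -> {in P, forall Q, 2 < #|Q|}.
Proof.
elim=> [h Q /set1P-> //|{}P Q i j _ IH QP iQ jQ ij ne Q'].
have [h1 h2] := card_cut_ge3 iQ jQ ij ne.
by case/setUP=> [/setD1P[_ /IH]//|/set2P[]->].
Qed.

Lemma subdivision_sub S P : subdivision S P -> {in P, forall Q, Q \subset S}.
Proof.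
elim=> [h Q /set1P-> //|{}P Q i j _ IH QP iQ jQ ij ne Q'].
case/setUP=> [/setD1P[_ /IH]//|/set2P[]->];
  exact: subset_trans (subsetIl _ _) (IH _ QP).
Qed.

Lemma subdivision_card_ge3 S P : subdivision S P -> 2 < #|S|.
Proof. by elim. Qed.

(** The two halves of a cut share only the ends of the cutting chord, and every other pair of
    polygons is contained in an older pair. *)
Lemma subdivision_cardI S P : subdivision S P ->
  {in P &, forall Q Q', Q != Q' -> #|Q :&: Q'| <= 2}.
Proof.
elim=> [h Q Q' /set1P-> /set1P->|{}P Q i j _ IH QP iQ jQ ij ne]; first by rewrite eqxx.
have mono (X Y Z W : {set 'I_n}) : X \subset Z -> Y \subset W -> #|Z :&: W| <= 2 ->
    #|X :&: Y| <= 2.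
  by move=> XZ YW; apply: leq_trans; apply/subset_leq_card/setISS.
have cut2 : #|(Q :&: cint i j) :&: (Q :&: cint j i)| <= 2.
  by rewrite setIACA setIid cintI (leq_trans (subset_leq_card (subsetIr _ _))) //
    cards2 ij.
have old (X Y : {set 'I_n}) : X \in P :\ Q -> Y \subset Q -> #|X :&: Y| <= 2.
  by case/setD1P=> nX XP YQ; apply: (mono _ _ X Q) => //; apply: IH.
move=> X Y /setUP[Xo|/set2P X2] /setUP[Yo|/set2P Y2] nXY.
- by case/setD1P: Xo => _ XP; case/setD1P: Yo => _ YP; apply: IH.
- by apply: old => //; case: Y2 => ->; apply: subsetIl.
- by rewrite setIC; apply: old => //; case: X2 => ->; apply: subsetIl.
by case: X2 Y2 nXY => -> [] ->; rewrite ?eqxx // => _; rewrite setIC.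
Qed.

(* The pieces produced by a cut are new, so sums over the family split. *)
Lemma big_subdivision_cut (P : {set {set 'I_n}}) Q i j (F : {set 'I_n} -> nat) :
    {in P &, forall Q Q', Q != Q' -> #|Q :&: Q'| <= 2} -> Q \in P ->
    i \in Q -> j \in Q -> i != j -> ~~ is_edge Q i j ->
  \sum_(X in (P :\ Q) :|: [set Q :&: cint i j; Q :&: cint j i]) F X + F Q =
  \sum_(X in P) F X + F (Q :&: cint i j) + F (Q :&: cint j i).
Proof.
move=> PI QP iQ jQ ij ne; have [h1 h2] := card_cut_ge3 iQ jQ ij ne.
have nin (X : {set 'I_n}) : 2 < #|X| -> X \subset Q -> X \notin P :\ Q.
  move=> cX XQ; apply/negP=> /setD1P[nX XP]; have := PI _ _ XP QP nX.
  by rewrite (setIidPl XQ) leqNgt cX.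
have n12 : Q :&: cint i j != Q :&: cint j i.
  apply/eqP=> e; have : 2 < #|(Q :&: cint i j) :&: (Q :&: cint j i)|.
    by rewrite -e setIid.
  rewrite setIACA setIid cintI ltnNge.
  by rewrite (leq_trans (subset_leq_card (subsetIr _ _))) // cards2 ij.
rewrite setUC -setUA !big_setU1 /=; first 1 last.
- by rewrite nin ?subsetIl.
- by rewrite in_setU in_set1 negb_or n12 nin ?subsetIl.
rewrite (big_setD1 _ QP) /= addnC -!addnA; congr (_ + _).
by rewrite [RHS]addnC -addnA.
Qed.

(** Geometrically, the chord (i, j) crosses no edge of Q in its interior. *)
Definition uncut i j Q : bool :=
  [|| Q \subset cint i j, Q \subset cint j i | (i \in Q) && (j \in Q)].

(** Polygons of a subdivision do not overlap, so an edge or diagonal of one cannot enter another;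
    for the two halves of one cut this is [cint_nested]. *)
Lemma subdivision_side S P : subdivision S P ->
  {in P &, forall Q Q', Q != Q' -> forall i j, i != j -> i \in Q -> j \in Q ->
     (Q' \subset cint i j) || (Q' \subset cint j i)}.
Proof.
elim=> [h Q Q' /set1P-> /set1P->|{}P Q a b _ IH QP aQ bQ ab ne]; first by rewrite eqxx.
have mono (X Y A B : {set 'I_n}) : X \subset Y ->
    (Y \subset A) || (Y \subset B) -> (X \subset A) || (X \subset B).
  by move=> XY /orP[]/(subset_trans XY)-> //; rewrite orbT.
move=> X Y /setUP[/setD1P[nX XP]|/set2P X2] /setUP[/setD1P[nY YP]|/set2P Y2] nXY i j
  ij iX jX.
- exact: (IH X Y).
- apply: (mono _ Q); last exact: (IH X Q).
  by case: Y2 => ->; apply: subsetIl.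
- apply: (IH Q Y) => //; first by rewrite eq_sym.
    by case: X2 iX => ->; case/setIP.
  by case: X2 jX => ->; case/setIP.
case: X2 Y2 nXY iX jX => -> [] ->; rewrite ?eqxx // => _ /setIP[_ hi] /setIP[_ hj].
  exact: mono (subsetIr _ _) (cint_nested ij hi hj).
exact: mono (subsetIr _ _) (cint_nested ij hi hj).
Qed.

Lemma subdivision_uncut S P : subdivision S P ->
  {in P, forall Q i j, i != j -> i \in Q -> j \in Q -> {in P, forall Q', uncut i j Q'}}.
Proof.
move=> SP Q QP i j ij iQ jQ Q' Q'P; rewrite /uncut orbA.
have [<-|nQ] := eqVneq Q Q'; first by rewrite iQ jQ orbT.
by rewrite (subdivision_side SP QP Q'P).
Qed.

Lemma card_sub2 i j (X : {set 'I_n}) : X \subset [set i; j] -> #|X| - 2 = 0.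
Proof.
move=> /subset_leq_card h; apply/eqP; rewrite subn_eq0 (leq_trans h) //.
by rewrite cards2; case: (_ != _).
Qed.

(** The number [#|Q :&: cint i j| - 2] counts the triangles in the part of Q left of (i, j), the
    truncated subtraction giving 0 for at most two vertices; such a count is additive under a
    cut. *)
Lemma uncut_cut i j a b Q : i != j -> a \in Q -> b \in Q -> a != b ->
    uncut i j (Q :&: cint a b) -> uncut i j (Q :&: cint b a) ->
  uncut i j Q /\
  (#|Q :&: cint i j| - 2 =
   (#|Q :&: cint a b :&: cint i j| - 2) + (#|Q :&: cint b a :&: cint i j| - 2)).
Proof.
move=> ij aQ bQ ab.
set Q1 := Q :&: cint a b; set Q2 := Q :&: cint b a; set A := cint i j.
have Q12 : Q = Q1 :|: Q2 by rewrite -setIUr cintU // setIT.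
have I12 : Q1 :&: Q2 = [set a; b].
  by rewrite setIACA setIid cintI (setIidPr _) // subUset !sub1set aQ.
have /setIP[a1 a2] : a \in Q1 :&: Q2 by rewrite I12 set21.
have /setIP[b1 b2] : b \in Q1 :&: Q2 by rewrite I12 set22.
have small (X : {set 'I_n}) : X \subset cint j i -> #|X :&: A| - 2 = 0.
  move=> XA; apply: (@card_sub2 i j); rewrite -cintI setIC.
  by apply: setIS.
move=> u1 u2.
have uQ : uncut i j Q.
  case/or3P: u1 => [s1|s1|/andP[/setIP[iQ _] /setIP[jQ _]]]; last 1 first.
  - by rewrite /uncut iQ jQ !orbT.
  - case/or3P: u2 => [s2|s2|/andP[/setIP[iQ _] /setIP[jQ _]]]; last 1 first.
    + by rewrite /uncut iQ jQ !orbT.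
    + by rewrite /uncut {1}Q12 subUset s1 s2.
    have : [set i; j] == [set a; b].
      rewrite eq_sym eqEcard !cards2 ij ab leqnn andbT -I12 -cintI.
      exact: setISS.
    by move/eqP=> e; rewrite /uncut -!sub1set -subUset e subUset !sub1set aQ bQ !orbT.
  case/or3P: u2 => [s2|s2|/andP[/setIP[iQ _] /setIP[jQ _]]]; last 1 first.
  - by rewrite /uncut iQ jQ !orbT.
  - have : [set i; j] == [set a; b].
      rewrite eq_sym eqEcard !cards2 ij ab leqnn andbT -I12 -cintI setIC.
      exact: setISS.
    by move/eqP=> e; rewrite /uncut -!sub1set -subUset e subUset !sub1set aQ bQ !orbT.
  by rewrite /uncut {2}Q12 subUset s1 s2 orbT.
split=> //.
(* If a and b both lie in [i, j], the two left parts share exactly a and b, and inclusion-exclusion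
   applies. Otherwise neither half is contained in [i, j], so each lies on the right and counts 0,
   or has both i and j as vertices. *)
have [abA|nabA] := boolP ((a \in A) && (b \in A)).
  have {abA} /andP[aA bA] := abA.
  have := cardsUI (Q1 :&: A) (Q2 :&: A).
  have abA : [set a; b] :&: A = [set a; b].
    by apply/setIidPl; rewrite subUset !sub1set aA.
  rewrite -setIUl -Q12 setIACA I12 setIid abA cards2 ab.
  have ge2 (X : {set 'I_n}) : a \in X -> b \in X -> 1 < #|X :&: A|.
    move=> aX bX; apply: (@leq_trans #|[set a; b]|); first by rewrite cards2 ab.
    by rewrite subset_leq_card // subUset !sub1set !in_setI aX bX aA.
  have := ge2 _ a1 b1; have := ge2 _ a2 b2; clear; lia.
have nsub (X : {set 'I_n}) : a \in X -> b \in X -> X \subset A = false.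
  by move=> aX bX; apply: contraNF nabA => /subsetP h; rewrite !h.
have eqA (X Y : {set 'I_n}) : X \subset cint j i -> (i \in Y) && (j \in Y) ->
    (X :|: Y) :&: A = Y :&: A.
  move=> XA ijY; rewrite setIUl; apply/setUidPr/subsetP=> l /setIP[lX lA].
  rewrite in_setI lA andbT.
  by case/orP: (cint_antisym lA (subsetP XA _ lX)) => /eqP->; case/andP: ijY.
move: u1 u2; rewrite /uncut !nsub //=.
case/orP=> [s1|ij1] /orP[s2|ij2].
- by rewrite !small // Q12 subUset s1.
- by rewrite (small Q1) // Q12 eqA.
- by rewrite (small Q2) // addn0 Q12 setUC eqA.
have : [set i; j] == [set a; b].
  rewrite eqEcard !cards2 ij ab leqnn andbT -I12 subsetI !subUset !sub1set.
  by rewrite ij1 ij2.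
move/eqP=> e; case/negP: nabA; rewrite -!sub1set -subUset -e subUset !sub1set.
by rewrite cint_l cint_r.
Qed.

Lemma subdivision_sum S P i j : i != j -> subdivision S P ->
    {in P, forall Q, uncut i j Q} ->
  uncut i j S /\
  \sum_(Q in P) (#|Q :&: cint i j| - 2) = #|S :&: cint i j| - 2.
Proof.
move=> ij; elim=> [h u|{}P Q a b SP IH QP aQ bQ ab ne u].
  by rewrite big_set1 u ?set11.
have [u1 u2] : uncut i j (Q :&: cint a b) /\ uncut i j (Q :&: cint b a).
  by split; apply: u; rewrite in_setU !in_set2 eqxx ?orbT.
have [uQ cutQ] := uncut_cut ij aQ bQ ab u1 u2.
have [|uS sumS] := IH.
  move=> X XP; have [->//|nX] := eqVneq X Q.
  by apply: u; rewrite in_setU in_setD1 nX XP.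
split=> //; rewrite -sumS.
have := big_subdivision_cut (fun X => #|X :&: cint i j| - 2)
  (subdivision_cardI SP) QP aQ bQ ab ne.
by rewrite cutQ -addnA => /addIn.
Qed.

Lemma subdivision_sum_total S P : subdivision S P ->
  \sum_(Q in P) (#|Q| - 2) = #|S| - 2.
Proof.
elim=> [h|{}P Q a b SP IH QP aQ bQ ab ne]; first by rewrite big_set1.
have := big_subdivision_cut (fun X => #|X| - 2)
  (subdivision_cardI SP) QP aQ bQ ab ne.
have := card_cut aQ bQ ab; have [] := card_cut_ge3 aQ bQ ab ne.
by rewrite IH; lia.
Qed.

Lemma sorted_enum_ord Q : sorted (fun a b : 'I_n => a < b) (enum Q).
Proof.
rewrite {1}/enum_mem; apply: sorted_filter => [a b c|]; first exact: ltn_trans.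
have : sorted ltn (map val (enum 'I_n)) by rewrite val_enum_ord iota_ltn_sorted.
by rewrite sorted_map -enumT.
Qed.

(** Cut until only triangles are left. Each polygon contributes at least 1 to
    [subdivision_sum_total], which bounds the number of polygons and hence of cuts. *)
Lemma triangulation_refine S P : subdivision S P ->
  exists2 T, triangulation S T & {in T, forall t : {set 'I_n}, exists2 Q, Q \in P & t
    \subset Q}.
Proof.
have [m] := ubnP (#|S| - 2 - #|P|); elim: m P => // m IH P lt_m SP.
have [/forall_inP h|] := boolP [forall Q in P, #|Q| == 3].
  by exists P; [split=> // t /h/eqP|move=> t tP; exists t].
rewrite negb_forall_in => /exists_inP[Q QP nQ3].
have [i [j [iQ jQ ij ne]]] : exists i j, [/\ i \in Q, j \in Q, i != j & ~~ is_edge Q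
  i j].
  have : 3 < size (enum Q).
    by rewrite -cardE ltn_neqAle eq_sym nQ3 (subdivision_card3 SP).
  have := sorted_enum_ord Q.
  have : {in enum Q, forall x, x \in Q} by move=> x; rewrite mem_enum.
  case: (enum Q) => [|a [|b [|c [|d s]]]] //= inQ.
  case/and4P=> ab bc cd _ _; exists a, c.
  have aQ : a \in Q by rewrite inQ // mem_head.
  have bQ : b \in Q by rewrite inQ // !inE eqxx ?orbT.
  have cQ : c \in Q by rewrite inQ // !inE eqxx ?orbT.
  have dQ : d \in Q by rewrite inQ // !inE eqxx ?orbT.
  have ac : a != c by rewrite -val_eqE /=; lia.
  split=> //; rewrite /is_edge ac aQ cQ /= negb_or; apply/andP; split.
    apply/negP=> /eqP/setP/(_ b); rewrite in_setI bQ in_set2 in_cint -!val_eqE /=.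
    by rewrite (_ : a <= c); lia.
  apply/negP=> /eqP/setP/(_ d); rewrite in_setI dQ in_set2 in_cint -!val_eqE /=.
  by rewrite (_ : (c <= a) = false); lia.
have SP' := subdivision_cut SP QP iQ jQ ij ne.
set P' := (P :\ Q) :|: _ in SP'.
have cP' : #|P'| = #|P|.+1.
  have := big_subdivision_cut (fun=> 1) (subdivision_cardI SP) QP iQ jQ ij ne.
  by rewrite -/P' !sum1_card; lia.
have leP' : #|P'| <= #|S| - 2.
  rewrite -(subdivision_sum_total SP') -sum1_card; apply: leq_sum => X XP'.
  by have := subdivision_card3 SP' XP'; lia.
have [|T TS sub] := IH P' _ SP'; first by lia.
exists T => // t /sub[X /setUP[/setD1P[_ XP]|/set2P X2] tX]; first by exists X.
by exists Q => //; apply: subset_trans tX _; case: X2 => ->; apply: subsetIl.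
Qed.

(** If (i, j) is a diagonal of S, cut S along it first; every refinement into triangles is then
    uncrossed. In the other cases S already lies on one side. *)
Lemma triangulation_uncrossed S i j : 2 < #|S| -> i != j -> uncut i j S ->
  exists2 T, triangulation S T & uncrossed T i j.
Proof.
move=> S3 ij.
suff sides P : subdivision S P ->
    {in P, forall Q, (Q \subset cint i j) || (Q \subset cint j i)} ->
    exists2 T, triangulation S T & uncrossed T i j.
  have triv : (S \subset cint i j) || (S \subset cint j i) ->
      exists2 T, triangulation S T & uncrossed T i j.
    by move=> h; apply: (sides _ (subdivision_trivial S3)) => Q /set1P->.
  rewrite /uncut orbA => /orP[//|/andP[iS jS]].
  have [|ne] := boolP (is_edge S i j).
    have edge (a b : 'I_n) : S :&: cint a b \subset [set a;
      b] -> a != b -> S \subset cint b a.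
      move=> /subsetP h nab; apply/subsetP=> l lS.
      have [la|la] := boolP (l \in cint a b); last by have := cint_cover l nab;
        rewrite (negPf la).
      by have := h l; rewrite in_setI lS la in_set2 => /(_ isT)/orP[]/eqP->;
        rewrite ?cint_l ?cint_r.
    rewrite /is_edge ij iS jS /= => /orP[]/eqP e; apply: triv; apply/orP.
      by right; apply: edge; rewrite ?e.
    by left; apply: edge; rewrite ?e 1?setUC // eq_sym.
  apply: (sides _ (subdivision_cut (subdivision_trivial S3) (set11 S) iS jS ij ne))
    => Q.
  case/setUP=> [/setD1P[/eqP nQ /set1P //]|].
  by case/set2P=> ->; rewrite subsetIr ?orbT.
move=> SP side; have [T TS sub] := triangulation_refine SP;
  exists T => // t /sub[Q QP tQ].
by case/orP: (side _ QP) => /(subset_trans tQ)->; rewrite ?orbT.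
Qed.

(** The last hypothesis makes (i, j) an edge of S. No cut crosses it, since one end of the cutting
    chord would be a vertex of S strictly between i and j. *)
Lemma subdivision_edge S P i j : subdivision S P -> i \in S -> j \in S -> i != j ->
  S :&: cint i j \subset [set i; j] -> exists2 Q, Q \in P & (i \in Q) && (j \in Q).
Proof.
move=> SP iS jS ij /subsetP eS;
  elim: SP => [_|{}P Q a b SP [X XP /andP[iX jX]] QP aQ bQ ab ne].
  by exists S; rewrite ?set11 ?iS.
have [eX|nX] := eqVneq X Q; last by exists X; rewrite ?iX // in_setU in_setD1 nX XP.
rewrite {}eX in iX jX.
have [h1|h1] := boolP ((i \in cint a b) && (j \in cint a b)).
  by exists (Q :&: cint a b); rewrite 1?in_setU ?set21 ?orbT // !in_setI iX jX.
have [h2|h2] := boolP ((i \in cint b a) && (j \in cint b a)).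
  by exists (Q :&: cint b a); rewrite 1?in_setU ?set22 ?orbT // !in_setI iX jX.
have QS := subsetP (subdivision_sub SP QP).
have [[/negPf ai /negPf aj /negPf bi /negPf bj]] := cint_cross ab h1 h2.
case/orP=> /andP[].
  by move=> aij _; have := eS a; rewrite in_setI in_set2 aij (QS a aQ) ai aj =>
    /(_ isT).
by move=> bij _; have := eS b; rewrite in_setI in_set2 bij (QS b bQ) bi bj => /(_ isT).
Qed.

(** Produces the polygon adjacent to the chord (i, j) on its left, or one having it as a diagonal;
    the induction in [ndesc_area] splits the arc at a vertex of it. *)
Lemma subdivision_between S P i j : subdivision S P -> i != j ->
    (exists2 Q, Q \in P & (i \in Q) && (j \in Q)) ->
    (exists l, [/\ l \in S, l \in cint i j, l != i & l != j]) ->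
  exists2 Q, Q \in P & (i \in Q) && (j \in Q) &&
    [exists l, [&& l \in Q, l \in cint i j, l != i & l != j]].
Proof.
move=> SP ij QP [l [lS lij li lj]].
elim: SP QP => [_ [Q /set1P-> /andP[iS jS]]|{}P Q a b SP IH QP aQ bQ ab ne [X XP
  /andP[iX jX]]].
  by exists S; rewrite ?set11 // iS jS; apply/existsP; exists l; apply/and4P.
have wit (Y : {set 'I_n}) l' : Y \in (P :\ Q) :|: [set Q :&: cint a b;
  Q :&: cint b a] ->
    i \in Y -> j \in Y -> l' \in Y -> l' \in cint i j -> l' != i -> l' != j ->
  exists2 Q0 : {set 'I_n}, Q0 \in (P :\ Q) :|: [set Q :&: cint a b; Q :&: cint b a] &
    (i \in Q0) && (j \in Q0) && [exists l, [&& l \in Q0, l \in cint i j, l != i & l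
      != j]].
  move=> YP iY jY lY h1 h2 h3; exists Y => //; rewrite iY jY.
  by apply/existsP; exists l'; apply/and4P.
have [|Y YP /andP[/andP[iY jY] /existsP[l0 /and4P[l0Y l0ij l0i l0j]]]] := IH.
  case/setUP: XP => [/setD1P[_ XP]|X2]; first by exists X; rewrite ?iX.
  by exists Q => //; case/set2P: X2 iX jX => -> /setIP[-> _] /setIP[-> _].
have [eY|nY] := eqVneq Y Q; last by apply: (wit Y l0);
  rewrite // in_setU in_setD1 nY YP.
rewrite {}eY in YP iY jY l0Y.
have new1 : Q :&: cint a b \in (P :\ Q) :|: [set Q :&: cint a b; Q :&: cint b a].
  by rewrite in_setU set21 orbT.
have new2 : Q :&: cint b a \in (P :\ Q) :|: [set Q :&: cint a b; Q :&: cint b a].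
  by rewrite in_setU set22 orbT.
(* With i and j in the half [Q :&: cint c d], the vertex strictly between them is the old one if it
   is in this half, or else an end of the cut other than i and j; failing both, {c, d} = {i, j}, and
   the other half contains i, j and the old vertex. *)
have side c d : Q :&: cint c d \in (P :\ Q) :|: [set Q :&: cint a b; Q :&: cint b a] ->
    Q :&: cint d c \in (P :\ Q) :|: [set Q :&: cint a b; Q :&: cint b a] ->
    c \in Q -> d \in Q -> c != d -> i \in cint c d -> j \in cint c d ->
  exists2 Q0 : {set 'I_n}, Q0 \in (P :\ Q) :|: [set Q :&: cint a b; Q :&: cint b a] &
    (i \in Q0) && (j \in Q0) && [exists l, [&& l \in Q0, l \in cint i j, l != i & l
      != j]].
  move=> hcd hdc cQ dQ cd hi hj.
  have [hl|hl] := boolP (l0 \in cint c d).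
    by apply: (wit _ l0 hcd); rewrite // in_setI ?iY ?jY ?l0Y.
  have [cij dij] := cint_between hi hj l0ij hl.
  have [cb|] := boolP ((c == i) || (c == j)); last first.
    rewrite negb_or => /andP[ci cj]; apply: (wit _ c hcd);
      rewrite // in_setI ?iY ?jY ?cQ //.
    exact: cint_l.
  have [db|] := boolP ((d == i) || (d == j)); last first.
    rewrite negb_or => /andP[di dj]; apply: (wit _ d hcd);
      rewrite // in_setI ?iY ?jY ?dQ //.
    exact: cint_r.
  have := cint_cover l0 cd; rewrite (negPf hl) /= => hl'.
  apply: (wit _ l0 hdc); rewrite // in_setI ?iY ?jY ?l0Y //=.
    by case/orP: cb db cd => /eqP-> /orP[]/eqP->; rewrite ?eqxx ?cint_l ?cint_r.
  by case/orP: cb db cd => /eqP-> /orP[]/eqP->; rewrite ?eqxx ?cint_l ?cint_r.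
have [/andP[hi hj]|h1] := boolP ((i \in cint a b) && (j \in cint a b)).
  exact: (side a b).
have [/andP[hi hj]|h2] := boolP ((i \in cint b a) && (j \in cint b a)).
  by apply: (side b a); rewrite // eq_sym.
exfalso; case/setUP: XP => [/setD1P[nX XP]|/set2P X2]; last first.
  case: X2 iX jX => -> /setIP[_ hi] /setIP[_ hj]; first by rewrite hi hj in h1.
  by rewrite hi hj in h2.
have [[ai aj bi bj] cr] := cint_cross ab h1 h2.
have sub := subdivision_side SP XP QP nX ij iX jX.
have bad c d : c \in cint i j -> d \in cint j i -> c \in Q -> d \in Q ->
    c != i -> c != j -> d != i -> d != j -> False.
  move=> cij dji cQ dQ ci cj di dj; case/orP: sub => /subsetP sub.
    by have := cint_antisym (sub _ dQ) dji; rewrite (negPf di) (negPf dj).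
  by have := cint_antisym cij (sub _ cQ); rewrite (negPf ci) (negPf cj).
by case/orP: cr => /andP[h h']; [apply: (bad a b)|apply: (bad b a)].
Qed.

End Subdivisions.

(** * Areas *)

Section Areas.
Variables (n : nat) (sigma : bicolored_subdivision n).
Implicit Types (i j l : 'I_n) (B Q : {set 'I_n}).

Let P := black sigma :|: white sigma.
Let subP : subdivision [set: 'I_n] P := black_white_subdivision sigma.

(** Closed form of the area: an r-gon has r - 2 triangles, and the truncated subtraction discards
    black polygons right of the arc. It agrees with [has_area] on compatible arcs. *)
Definition area i j : nat := \sum_(B in black sigma) (#|B :&: cint i j| - 2).

Lemma black_polygon B : B \in black sigma -> B \in P.
Proof. by move=> h; rewrite in_setU h. Qed.

Lemma compatible_uncut i j B : compatible sigma i j -> B \in P -> uncut i j B.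
Proof.
case=> ij [Q QP /andP[iQ jQ]] BP; exact: (subdivision_uncut subP QP ij iQ jQ).
Qed.

Lemma sum_black_triangulation (tau : {set 'I_n} -> {set {set 'I_n}})
    (F : {set 'I_n} -> nat) :
    (forall B, B \in black sigma -> triangulation B (tau B)) ->
  \sum_(t in \bigcup_(B in black sigma) tau B) F t =
  \sum_(B in black sigma) \sum_(t in tau B) F t.
Proof.
move=> tauP.
pose tau' B := if B \in black sigma then tau B else set0.
have -> : \bigcup_(B in black sigma) tau B = \bigcup_B tau' B.
  by rewrite big_mkcond.
rewrite partition_disjoint_bigcup => [|B B' nBB'].
  rewrite [RHS]big_mkcond; apply: eq_bigr => B _; rewrite /tau'.
  by case: ifP => // _; rewrite big_set0.
rewrite -setI_eq0 /tau'; case: ifP => bB; last by rewrite set0I.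
case: ifP => bB'; last by rewrite setI0.
apply/eqP/setP=> t; rewrite in_set0; apply/negP=> /setIP[tB tB'].
have [sB t3] := tauP _ bB; have [sB' _] := tauP _ bB'.
have := subdivision_cardI subP (black_polygon bB) (black_polygon bB') nBB'.
rewrite leqNgt -(t3 _ tB) subset_leq_card //.
by rewrite subsetI (subdivision_sub sB tB) (subdivision_sub sB' tB').
Qed.

Lemma triangles_left i j T : compatible sigma i j ->
  black_triangulation sigma T -> uncrossed T i j ->
  #|[set t in T | t \subset cint i j]| = area i j.
Proof.
move=> [ij _] [tau tauP ->] unT.
have -> (T' : {set {set 'I_n}}) :
    #|[set t in T' | t \subset cint i j]| = \sum_(t in T') (t \subset cint i j).
  rewrite -sum1_card big_mkcond [RHS]big_mkcond; apply: eq_bigr => t _.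
  by rewrite inE; case: (t \in T') => //=; case: ifP.
rewrite (sum_black_triangulation _ tauP); apply: eq_bigr => B bB.
have [sB t3] := tauP _ bB.
have uB : {in tau B, forall t, uncut i j t}.
  move=> t tB; rewrite /uncut orbA.
  by rewrite (unT t) //; apply/bigcupP; exists B.
have [_ <-] := subdivision_sum ij sB uB; apply: eq_bigr => t tB.
case: (boolP (t \subset _)) => [/setIidPl->|nt]; first by rewrite t3.
have /orP[|st] : (t \subset cint i j) || (t \subset cint j i).
- by apply: unT; apply/bigcupP; exists B.
- by rewrite (negPf nt).
symmetry; apply: (@card_sub2 _ i j); rewrite -cintI setIC; exact: setIS.
Qed.

Lemma black_triangulation_uncrossed i j : compatible sigma i j ->
  exists2 T, black_triangulation sigma T & uncrossed T i j.
Proof.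
move=> cij.
have : forall B, exists TB, B \in black sigma -> triangulation B TB /\ uncrossed TB i j.
  move=> B; have [bB|] := boolP (B \in black sigma); last by exists set0.
  have BP := black_polygon bB.
  have [TB h1 h2] := triangulation_uncrossed (subdivision_card3 subP BP) (proj1 cij)
    (compatible_uncut cij BP).
  by exists TB.
case/choice=> tau tauP; exists (\bigcup_(B in black sigma) tau B).
  by exists tau => // B /tauP[].
by move=> t /bigcupP[B /tauP[_ h] /h].
Qed.

(** Some black triangulation is not crossed by (i, j), so [has_area] is not vacuous and determines
    a. *)
Lemma has_areaP i j a : compatible sigma i j -> has_area sigma i j a <-> a = area i j.
Proof.
move=> cij; split=> [h|-> T hT uT]; last exact: triangles_left.
have [T hT uT] := black_triangulation_uncrossed cij.
by rewrite -(h T hT uT) triangles_left.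
Qed.

Lemma type_sum k : has_type sigma k -> k = \sum_(B in black sigma) (#|B| - 2).
Proof.
move=> hk.
have : forall B, exists TB, B \in black sigma -> triangulation B TB.
  move=> B; have [bB|] := boolP (B \in black sigma); last by exists set0.
  have B3 := subdivision_card3 subP (black_polygon bB).
  by have [TB h _] := triangulation_refine (subdivision_trivial B3); exists TB.
case/choice=> tau tauP.
rewrite -(hk (\bigcup_(B in black sigma) tau B)); last by exists tau.
rewrite -sum1_card (sum_black_triangulation _ tauP); apply: eq_bigr => B bB.
have [sB t3] := tauP _ bB; rewrite -(subdivision_sum_total sB).
by apply: eq_bigr => t tB; rewrite t3.
Qed.

Lemma area_compl i j : compatible sigma i j ->
  area i j + area j i = \sum_(B in black sigma) (#|B| - 2).
Proof.
move=> cij; have [ij _] := cij; rewrite -big_split; apply: eq_bigr => B bB /=.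
have small (c d : 'I_n) : B \subset cint c d -> #|B :&: cint d c| - 2 = 0.
  by move=> h; apply: (@card_sub2 _ c d); rewrite -cintI; apply: setSI.
case/or3P: (compatible_uncut cij (black_polygon bB)) => [h|h|/andP[iB jB]].
- by rewrite (setIidPl h) (small i j h) addn0.
- by rewrite (setIidPl h) (small j i h).
have arith x y z : 1 < x -> 1 < y -> x + y = z + 2 -> (x - 2) + (y - 2) = z - 2.
  by lia.
apply: arith (card_cut iB jB ij); first exact: card_cut_ge2.
by apply: card_cut_ge2; rewrite // eq_sym.
Qed.

(** The triangle i, l, j of Q separates the regions left of the two shorter arcs from the chord (i,
    j); it adds 1 to the count exactly when Q is black. *)
Lemma area_split Q i l j : Q \in P -> i \in Q -> l \in Q -> j \in Q -> i < l -> l < j ->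
  area i j = area i l + area l j + (Q \in black sigma).
Proof.
move=> QP iQ lQ jQ il lj.
have il' : i != l by rewrite -val_eqE /= neq_ltn il.
have lj' : l != j by rewrite -val_eqE /= neq_ltn lj.
have ij : i < j := ltn_trans il lj.
have ij' : i != j by rewrite -val_eqE /= neq_ltn ij.
have cE (u v x : 'I_n) : u < v -> (x \in cint u v) = (u <= x <= v).
  by move=> uv; rewrite in_cint ltnW.
have cE' (u v x : 'I_n) : u < v -> (x \in cint v u) = (v <= x) || (x <= u).
  by move=> uv; rewrite in_cint leqNgt uv.
have other B : B \in P -> B != Q ->
    #|B :&: cint i j| - 2 = (#|B :&: cint i l| - 2) + (#|B :&: cint l j| - 2).
  move=> BP nBQ.
  have small (c d : 'I_n) : B \subset cint d c -> #|B :&: cint c d| - 2 = 0.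
    by move=> h; apply: (@card_sub2 _ d c); rewrite -cintI; apply: setSI.
  have nQB : Q != B by rewrite eq_sym.
  have sIl : [set l] = cint i l :&: cint l j.
    apply/setP=> x; rewrite in_setI !cE // in_set1 -val_eqE /=; clear -il lj; lia.
  have [h1|h1] := boolP (B \subset cint i l).
    have -> : B :&: cint i j = B :&: cint i l.
      apply/setP=> x; rewrite !in_setI; case xB: (x \in B) => //=.
      have := subsetP h1 x xB; rewrite !cE //; clear -il lj; lia.
    have : B :&: cint l j \subset [set l; l] by rewrite setUid sIl setSI.
    by move/card_sub2->; rewrite addn0.
  have [h2|h2] := boolP (B \subset cint l j).
    have -> : B :&: cint i j = B :&: cint l j.
      apply/setP=> x; rewrite !in_setI; case xB: (x \in B) => //=.
      have := subsetP h2 x xB; rewrite !cE //; clear -il lj; lia.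
    have : B :&: cint i l \subset [set l; l] by rewrite setUid sIl setIC setIS.
    by move/card_sub2->.
  have := subdivision_side subP QP BP nQB il' iQ lQ; rewrite (negPf h1) /= => h1'.
  have := subdivision_side subP QP BP nQB lj' lQ jQ; rewrite (negPf h2) /= => h2'.
  rewrite (small i l) // (small l j) //.
  case/orP: (subdivision_side subP QP BP nQB ij' iQ jQ) => h3; last by rewrite small.
  (* Right of (i, l) and of (l, j) but left of (i, j), B can only have the vertices i, l, j. Then it
     lies in Q and has at most two vertices, so it counts 0. *)
  have BQ : B \subset Q.
    apply/subsetP=> x xB; suff : [|| x == i, x == l | x == j].
      by case/or3P=> /eqP->.
    have := subsetP h1' x xB; have := subsetP h2' x xB; have := subsetP h3 x xB.
    rewrite (cE i j) // (cE' i l) // (cE' l j) // -!val_eqE /=; clear -il lj; lia.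
  have := subdivision_cardI subP BP QP nBQ; rewrite (setIidPl BQ).
  move=> B2; apply/eqP; rewrite subn_eq0; apply: leq_trans B2.
  exact/subset_leq_card/subsetIl.
(* The two parts overlap in l only: if N vertices lie in [i, j], they give N + 1 - 4 triangles, one
   less than N - 2. *)
have same : #|Q :&: cint i j| - 2 = (#|Q :&: cint i l| - 2) + (#|Q :&: cint l j| - 2)
  + 1.
  have := cardsUI (Q :&: cint i l) (Q :&: cint l j).
  rewrite -setIUr setIACA setIid.
  have -> : cint i l :|: cint l j = cint i j.
    apply/setP=> x; rewrite in_setU !cE //; clear -il lj; lia.
  have -> : cint i l :&: cint l j = [set l].
    apply/setP=> x; rewrite in_setI !cE // in_set1 -val_eqE /=; clear -il lj; lia.
  have -> : Q :&: [set l] = [set l] by apply/setIidPr; rewrite sub1set.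
  have arith x y z : x + 1 = y + z -> 1 < y -> 1 < z -> x - 2 = (y - 2) + (z - 2) + 1.
    by lia.
  by rewrite cards1 => h; apply: arith h _ _; apply: card_cut_ge2.
rewrite /area -big_split /=; case: (boolP (Q \in black sigma)) => [bQ|wQ].
  rewrite (big_setD1 _ bQ) [in RHS](big_setD1 _ bQ) /= same.
  rewrite addn1 addSn [in RHS]addnAC addn1 addSn; congr (_.+1); congr (_ + _).
  by apply: eq_bigr => B /setD1P[nB bB]; rewrite other // black_polygon.
rewrite addn0; apply: eq_bigr => B bB; apply: other; first exact: black_polygon.
by apply: contraNneq wQ => <-.
Qed.

Lemma compatible_consecutive i j : j = i.+1 :> nat -> compatible sigma i j.
Proof.
move=> e; have ij : i != j by rewrite -val_eqE /= e; lia.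
split=> //; apply: (subdivision_edge subP); rewrite ?in_setT //.
by apply/subsetP=> x; rewrite setTI in_cint in_set2 -!val_eqE /= e leqnSn; lia.
Qed.

Lemma n_gt2 : 2 < n.
Proof. by have := subdivision_card_ge3 subP; rewrite cardsT card_ord. Qed.

Lemma compatible_ends i j : i = 0 :> nat -> j.+1 = n -> compatible sigma i j.
Proof.
move=> e ej; have n3 := n_gt2; have ij : i != j by rewrite -val_eqE /= e; lia.
split=> //; have [] := @subdivision_edge _ _ _ j i subP; rewrite ?in_setT 1?eq_sym //.
  apply/subsetP=> x; have := ltn_ord x.
  rewrite setTI in_cint in_set2 -!val_eqE /= e.
  by rewrite (_ : (j <= 0) = false); lia.
by move=> Q QP /andP[jQ iQ]; exists Q; rewrite ?iQ.
Qed.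

Lemma area_consecutive i j : j = i.+1 :> nat -> area i j = 0.
Proof.
move=> e; apply: big1 => B _; apply: (@card_sub2 _ i j).
by apply/subsetP=> x /setIP[_]; rewrite in_cint in_set2 -!val_eqE /= e leqnSn; lia.
Qed.

Lemma area_ends i j : i = 0 :> nat -> j.+1 = n ->
  area i j = \sum_(B in black sigma) (#|B| - 2).
Proof.
move=> e ej; apply: eq_bigr => B _; congr (#|pred_of_set _| - 2).
apply/setIidPl/subsetP=> x _; have := ltn_ord x; rewrite in_cint e !leq0n /=; lia.
Qed.

End Areas.

(** * Cyclic words *)

Section Turns.
Variable T : eqType.
Implicit Types (s v : seq T) (a b x : T).

(** As a number, it counts how often the way from a to b around the circle passes from the end of s
    to its start. *)
Definition turn s a b : bool := index b s < index a s.

Lemma turn_subseq s v a b : uniq s -> subseq v s -> a \in v -> b \in v ->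
  turn s a b = turn v a b.
Proof.
rewrite /turn; elim: s v => [|x s IH] [|y v] //= /andP[xs us].
case: (eqVneq y x) => [->|nyx] vs; last first.
  move=> av bv; have sub := mem_subseq vs.
  have nx c : c \in y :: v -> (x == c) = false.
    by move=> cv; apply: contraNF xs => /eqP->; apply: sub.
  by rewrite !nx // ltnS (IH (y :: v)).
rewrite !inE !(eq_sym x).
case: (eqVneq a x) => [->|_] //=.
case: (eqVneq b x) => [->|_] //= av bv.
by rewrite ltnS (IH v).
Qed.

(** A rotation moves the letters of [take m s] behind the others, so [turn] changes by the
    difference of an indicator function at a and b; such differences cancel in the relation
    [oriented] below. *)
Lemma turn_rot m s a b : uniq s -> a \in s -> b \in s ->
  turn (rot m s) a b + (b \in take m s) = turn s a b + (a \in take m s).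
Proof.
rewrite /turn /rot; move: (cat_take_drop m s).
move: (take m s) (drop m s) => t d <-; rewrite cat_uniq !mem_cat !index_cat.
move=> /and3P[_ /hasPn disj _] ha hb.
have dt c : (c \in t) || (c \in d) -> c \in d = (c \notin t).
  by case ct: (c \in t) => //= _; apply/negbTE/negP=> /disj; rewrite /= ct.
have il c : c \in t -> index c t < size t by rewrite index_mem.
have ir c : c \notin t -> (c \in t) || (c \in d) -> index c d < size d.
  by move=> /negPf-> /=; rewrite index_mem.
rewrite (dt a) // (dt b) //.
case ta: (a \in t); case tb: (b \in t) => /=; rewrite ?ltn_add2l //.
  have := il _ ta; have := ir _ (negbT tb) hb; clear; lia.
have := il _ tb; have := ir _ (negbT ta) ha; clear; lia.
Qed.

Lemma turn_compl s a b : a != b -> a \in s -> b \in s -> turn s a b + turn s b a = 1.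
Proof.
move=> ab ha hb; rewrite /turn; case: ltngtP => // e.
by case/eqP: ab; rewrite -(nth_index a ha) -(nth_index a hb) e.
Qed.

Lemma turn_sorted (e : rel T) v a b : transitive e -> irreflexive e -> sorted e v ->
  a \in v -> b \in v -> e a b -> index a v < index b v.
Proof.
move=> etr eirr sv av bv eab; rewrite ltnNge leq_eqVlt; apply/negP=> /orP[/eqP eq|].
  by rewrite -(nth_index a av) -(nth_index a bv) eq eirr in eab.
move=> /(sorted_ltn_index etr sv b a bv av) eba.
by have := etr _ _ _ eab eba; rewrite eirr.
Qed.

Lemma subseq_turn s v : uniq s -> {subset v <= s} ->
  sorted (fun a b => index a s < index b s) v -> subseq v s.
Proof.
move=> us vs sv.
have tr : transitive (fun a b => index a s < index b s) by move=> ? ? ?;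
  apply: ltn_trans.
have -> : v = filter (mem v) s; last exact: filter_subseq.
apply: (irr_sorted_eq tr) => //; first by move=> x; rewrite /= ltnn.
  apply: sorted_filter => //; suff : sorted ltn (map (index^~ s) s) by rewrite
    sorted_map.
  have -> : map (index^~ s) s = iota 0 (size s); last exact: iota_ltn_sorted.
  case: s us {vs sv tr} => // x0 s us; apply: (@eq_from_nth _ 0);
    first by rewrite size_map size_iota.
  by move=> i; rewrite size_map => lti; rewrite (nth_map x0) // nth_iota // index_uniq.
move=> x; rewrite mem_filter /=; case xv: (x \in v) => //=.
by rewrite vs.
Qed.

End Turns.

Lemma word_uniq n (w : 'S_n) : uniq (word w).
Proof. by rewrite map_inj_uniq ?enum_uniq //; apply: perm_inj. Qed.

Lemma mem_word n (w : 'S_n) i : i \in word w.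
Proof. by apply/mapP; exists (w^-1%g i); rewrite ?mem_enum ?permKV. Qed.

(** * Orientation of polygons in a cyclic word, and gluing of words *)

Section Orientation.
Variable n : nat.
Implicit Types (s v : seq 'I_n) (i j l a b : 'I_n) (Q S : {set 'I_n}).

Definition polygon_word Q (c : bool) := if c then rev (enum Q) else enum Q.

Lemma mem_polygon_word Q c : polygon_word Q c =i Q.
Proof. by move=> i; case: c; rewrite /= ?mem_rev mem_enum. Qed.

Lemma polygon_word_uniq Q c : uniq (polygon_word Q c).
Proof. by case: c; rewrite /= ?rev_uniq enum_uniq. Qed.

Lemma polygon_word_sorted Q c :
  sorted (fun a b : 'I_n => if c then b < a else a < b) (polygon_word Q c).
Proof. by case: c; rewrite /= ?rev_sorted sorted_enum_ord. Qed.

Lemma turn_polygon_word Q c i j : i \in Q -> j \in Q -> i < j ->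
  turn (polygon_word Q c) i j = c.
Proof.
move=> iQ jQ ij; rewrite /turn.
have tr : transitive (fun a b : 'I_n => if c then b < a else a < b).
  by case: c => x y z h1 h2; [apply: ltn_trans h2 h1|apply: ltn_trans h1 h2].
have irr : irreflexive (fun a b : 'I_n => if c then b < a else a < b).
  by move=> x; rewrite ltnn if_same.
have key a b := @turn_sorted _ _ _ a b tr irr (polygon_word_sorted Q c).
case: c key {tr irr} => key.
  by apply: key; rewrite ?mem_polygon_word.
by apply/negbTE; rewrite -leqNgt ltnW //; apply: key; rewrite ?mem_polygon_word.
Qed.

(* The vertices of Q occur clockwise in the cyclic word s if c is false, and
   counterclockwise if c is true. *)
Definition oriented s Q (c : bool) : Prop :=
  forall i l j, i \in Q -> l \in Q -> j \in Q -> i < l -> l < j ->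
    turn s i l + turn s l j = turn s i j + c.

(** In the polygon word itself [turn] is c on every increasing pair; the changes caused by a
    rotation cancel, so any r will do. *)
Lemma oriented_subseq s Q c r :
  uniq s -> subseq (rot r (polygon_word Q c)) s -> oriented s Q c.
Proof.
move=> us sub i l j iQ lQ jQ il lj.
have step a b : a \in Q -> b \in Q -> a < b ->
    turn s a b + (b \in take r (polygon_word Q c)) = c + (a \in take r (polygon_word
      Q c)).
  move=> aQ bQ ab; rewrite (turn_subseq us sub) ?mem_rot ?mem_polygon_word //.
  rewrite turn_rot ?polygon_word_uniq ?mem_polygon_word //.
  by rewrite turn_polygon_word.
have := step _ _ iQ lQ il; have := step _ _ lQ jQ lj.
have := step _ _ iQ jQ (ltn_trans il lj).
clear; lia.
Qed.

Lemma oriented_in_cyclic_order (w : 'S_n) Q c :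
    in_cyclic_order (polygon_word Q c) w <-> oriented (word w) Q c.
Proof.
have uw := word_uniq w; have inw := mem_word w.
split.
  rewrite /in_cyclic_order; case E: (polygon_word Q c) => [|v1 v].
    move=> _ i l j iQ; have := mem_polygon_word Q c i; by rewrite E iQ.
  rewrite -E => sub; set m := index v1 _ in sub.
  have [k _] := subseq_rot (size (word w) - m) sub.
  have -> : rot (size (word w) - m) (rot m (word w)) = word w.
    by rewrite -[X in X - m](size_rot m); apply: rotK.
  by move=> h; apply: oriented_subseq h.
move=> ori; rewrite /in_cyclic_order; case E: (polygon_word Q c) => [|v1 v] //.
rewrite -E; set m := index v1 _.
have v1Q : v1 \in Q by rewrite -(mem_polygon_word Q c) E mem_head.
apply: subseq_turn; rewrite ?rot_uniq //; first by move=> x _; rewrite mem_rot inw.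
have utake x : (x \in take m (word w)) = turn (word w) v1 x by rewrite in_take.
have tr : transitive (fun a b : 'I_n => if c then b < a else a < b).
  by case: c {ori E} => x y z h1 h2; [apply: ltn_trans h2 h1|apply: ltn_trans h1 h2].
have srt : path (fun a b : 'I_n => if c then b < a else a < b) v1 v.
  by have := polygon_word_sorted Q c; rewrite E.
have min := order_path_min tr srt.
(* The rotated word starts at v1, which is also first in the order of the polygon word, so the
   relation for the triple formed by v1, a and b excludes that b precedes a. *)
have pre a b : a \in Q -> b \in Q -> (if c then b < a else a < b) ->
    index a (rot m (word w)) < index b (rot m (word w)).
  move=> aQ bQ ab.
  have nab : a != b by rewrite -val_eqE /= neq_ltn; case: (c) ab => ->; rewrite ?orbT.
  have cmp : turn (rot m (word w)) a b + turn (rot m (word w)) b a = 1.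
    by rewrite turn_compl // mem_rot.
  suff : turn (rot m (word w)) a b = false by rewrite -/(turn _ b a);
    case: turn cmp => //; case: turn.
  have := turn_rot m uw (inw a) (inw b); rewrite !utake.
  have [->|nav] := eqVneq a v1.
    by rewrite [turn _ v1 v1]/turn ltnn addn0; case: (turn (rot _ _) v1 b) => //;
      case: turn.
  have va : if c then a < v1 else v1 < a.
    have : a \in v1 :: v by rewrite -E mem_polygon_word.
    by rewrite inE (negPf nav) => /(allP min).
  case: c ab va ori {E tr srt min} => ab va ori.
    have := ori b a v1 bQ aQ v1Q ab va.
    have := turn_compl nab (inw a) (inw b); have := turn_compl nav (inw a) (inw v1).
    have nbv : b != v1 by rewrite -val_eqE /= neq_ltn (ltn_trans ab va).
    by have := turn_compl nbv (inw b) (inw v1); do ![case: (turn _ _ _)].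
  by have := ori v1 a b v1Q aQ bQ va ab; do ![case: (turn _ _ _)].
apply: (@sub_in_sorted _ (mem Q) _ _ pre) (polygon_word_sorted Q c).
by apply/allP=> x; rewrite mem_polygon_word.
Qed.

Lemma glue_words (a b : 'I_n) s1 s2 S :
    a \in S -> b \in S -> a != b -> uniq s1 -> uniq s2 ->
    s1 =i S :&: cint a b -> s2 =i S :&: cint b a ->
  exists s, [/\ uniq s, s =i S, exists r, subseq (rot r s1) s & exists r, subseq (rot
    r s2) s].
Proof.
move=> aS bS ab u1 u2 e1 e2.
have [a1 b1] : a \in s1 /\ b \in s1 by rewrite !e1 !in_setI aS bS cint_l cint_r.
have [a2 b2] : a \in s2 /\ b \in s2 by rewrite !e2 !in_setI aS bS cint_l cint_r.
have [r1 p1 q1 _ _ E1] := rot_to_arc u1 a1 b1 ab.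
have [r2 p2 q2 _ _ E2] := rot_to_arc u2 a2 b2 ab.
(* [p1] and [p2] are the arcs from a to b in the two cyclic words, [q1] and [q2] those from b back
   to a. Concatenating them keeps both cyclic words as subsequences. *)
pose s := a :: (p1 ++ p2) ++ b :: (q1 ++ q2).
have sS : s =i S.
  move=> x; have -> : (x \in s) = (x \in s1) || (x \in s2).
    rewrite -(mem_rot r1 s1) E1 -(mem_rot r2 s2) E2 !(inE, mem_cat).
    by do ![case: (_ == _) => //=]; do ![case: (_ \in _) => //=].
  rewrite e1 e2 !in_setI -andb_orr.
  by have := cint_cover x ab; case/orP=> ->; rewrite ?orbT andbT.
exists s; split=> //.
- rewrite (@uniq_size_uniq _ (enum S)) ?enum_uniq //; last by move=> x;
  rewrite mem_enum sS.
  have c1 : size s1 = #|S :&: cint a b| by rewrite -(card_uniqP u1); apply: eq_card.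
  have c2 : size s2 = #|S :&: cint b a| by rewrite -(card_uniqP u2); apply: eq_card.
  have := card_cut aS bS ab; rewrite -c1 -c2 -(size_rot r1 s1) E1 -(size_rot r2 s2)
    E2 -cardE.
  by rewrite /s /= !size_cat /= !size_cat => h; apply/eqP; move: h; clear; lia.
- exists r1; rewrite E1 /s /= eqxx.
  by apply: cat_subseq; [apply: prefix_subseq|rewrite /= eqxx prefix_subseq].
- exists r2; rewrite E2 /s /= eqxx.
  by apply: cat_subseq; [apply: suffix_subseq|rewrite /= eqxx suffix_subseq].
Qed.

(** The inductive definition exposes the last cut, whereas gluing needs the first one; each later
    cut is moved into the half containing the polygon that it cuts. *)
Lemma subdivision_first_cut S (P : {set {set 'I_n}}) : subdivision S P ->
  P = [set S] \/
  exists a b P1 P2, [/\ [/\ a \in S, b \in S, a != b & ~~ is_edge S a b],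
    subdivision (S :&: cint a b) P1, subdivision (S :&: cint b a) P2 & P = P1 :|: P2].
Proof.
elim=> [h|{}P Q i j SP IH QP iQ jQ ij ne]; [by left|right].
case: IH => [eP|[a [b [P1 [P2 [[aS bS ab nab] SP1 SP2 eP]]]]]].
  move: QP iQ jQ ne; rewrite {}eP => /set1P-> iS jS ne.
  have [h1 h2] := card_cut_ge3 iS jS ij ne.
  exists i, j, [set S :&: cint i j], [set S :&: cint j i]; split=> //;
    try exact: subdivision_trivial.
  by rewrite setDv set0U.
have sub (c d : 'I_n) P1' P2' : subdivision (S :&: cint c d) P1' ->
    subdivision (S :&: cint d c) P2' -> Q \in P1' -> c != d ->
    (P1' :|: P2') :\ Q = (P1' :\ Q) :|: P2'.
  move=> S1 S2 Q1 cd; rewrite setDUl; congr (_ :|: _); apply/setDidPl.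
  rewrite disjoint_sym disjoints1; apply/negP=> Q2.
  have := subdivision_card3 S1 Q1; rewrite ltnNge => /negP; apply.
  apply: (@leq_trans #|[set c; d]|); last by rewrite cards2; case: (_ != _).
  rewrite subset_leq_card // -cintI subsetI.
  have := subdivision_sub S1 Q1; have := subdivision_sub S2 Q2.
  by rewrite !subsetI => /andP[_ ->] /andP[_ ->].
move: (QP); rewrite eP => /setUP[Q1|Q2].
  exists a, b, ((P1 :\ Q) :|: [set Q :&: cint i j; Q :&: cint j i]), P2; split=> //.
    exact: subdivision_cut.
  by rewrite (sub a b) // setUAC.
exists a, b, P1, ((P2 :\ Q) :|: [set Q :&: cint i j; Q :&: cint j i]); split=> //.
  exact: subdivision_cut.
by rewrite (setUC P1 P2) (sub b a P2 P1) 1?eq_sym // (setUC _ P1) -setUA.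
Qed.

(** Orientations can be prescribed freely: the two halves of a cut share only the ends of the chord,
    so their cyclic words glue without conflict. *)
Lemma oriented_word_exists S (P : {set {set 'I_n}}) (c : {set 'I_n} -> bool) :
  subdivision S P ->
  exists s, [/\ uniq s, s =i S & {in P, forall Q : {set 'I_n},
    exists r, subseq (rot r (polygon_word Q (c Q))) s}].
Proof.
have [m] := ubnP #|S|; elim: m S P => // m IH S P lt_m SP.
have [->|[a [b [P1 [P2 [[aS bS ab nab] SP1 SP2 ->]]]]]] := subdivision_first_cut SP.
  exists (polygon_word S (c S)); split;
    [exact: polygon_word_uniq|exact: mem_polygon_word|].
  by move=> Q /set1P->; exists 0; rewrite rot0.
have [h1 h2] := card_cut_ge3 aS bS ab nab; have hS := card_cut aS bS ab.
have [|s1 [u1 e1 o1]] := IH _ _ _ SP1; first by move: h1 h2 hS lt_m; clear; lia.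
have [|s2 [u2 e2 o2]] := IH _ _ _ SP2; first by move: h1 h2 hS lt_m; clear; lia.
have [s [us sS [r1 sub1] [r2 sub2]]] := glue_words aS bS ab u1 u2 e1 e2.
exists s; split=> // Q /setUP[/o1|/o2] [r sub].
  have [k _ h] := subseq_rot r1 sub; rewrite rot_rot_add in h.
  by eexists; apply: subseq_trans h sub1.
have [k _ h] := subseq_rot r2 sub; rewrite rot_rot_add in h.
by eexists; apply: subseq_trans h sub2.
Qed.

End Orientation.

(** * Full turns and areas *)

Section Descents.
Variables (n : nat) (sigma : bicolored_subdivision n).
Implicit Types (s : seq 'I_n) (i j l : 'I_n) (Q : {set 'I_n}).

Definition sigma_oriented s : Prop :=
  {in black sigma :|: white sigma, forall Q, oriented s Q (Q \in black sigma)}.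

(** The number of full turns around s made by the walk 0, 1, ..., m. *)
Definition ndesc s (m : nat) : nat := \sum_(l < n | l < m) turn s l (ordS l).

Lemma ndescS s i : ndesc s i.+1 = ndesc s i + turn s i (ordS i).
Proof.
rewrite /ndesc (bigD1 i) ?ltnSn //= addnC; congr (_ + _).
by apply: eq_bigl => l; rewrite ltnS -val_eqE /= (ltn_neqAle l) andbC.
Qed.

Lemma val_ordS i j : j = i.+1 :> nat -> ordS i = j.
Proof.
by move=> e; apply: val_inj; rewrite /= e modn_small // -e ltn_ord.
Qed.

(** Walking from i to j by unit steps makes [area] full turns more than the direct step. At a vertex
    l of a polygon with i and j, [oriented] and [area_split] have the same correction term, so the
    induction on j - i goes through. *)
Lemma ndesc_area s i j : sigma_oriented s -> compatible sigma i j -> i < j ->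
  ndesc s j = ndesc s i + area sigma i j + turn s i j.
Proof.
move=> ori; have [m] := ubnP (j - i); elim: m i j => // m IH i j lt_m cij ij.
have [e|ne] := eqVneq (j : nat) i.+1.
  by rewrite area_consecutive // addn0 {1}e ndescS (val_ordS e).
have [ij' exQ] := cij.
have i1n : i.+1 < n by apply: leq_ltn_trans (ltn_ord j).
have [|Q QP] := subdivision_between (black_white_subdivision sigma) ij' exQ.
  exists (Ordinal i1n); split; rewrite ?in_setT // ?in_cint -?val_eqE /=.
  - by rewrite ltnW // leqnSn.
  - by rewrite neq_ltn ltnSn orbT.
  - by rewrite eq_sym.
case/andP=> /andP[iQ jQ] /existsP[l /and4P[lQ]].
rewrite in_cint (ltnW ij) -!val_eqE /= => /andP[le1 le2] ne1 ne2.
have il : i < l by rewrite ltn_neqAle eq_sym ne1.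
have lj : l < j by rewrite ltn_neqAle ne2.
have comp (u v : 'I_n) : u \in Q -> v \in Q -> u < v -> compatible sigma u v.
  move=> uQ vQ uv; split; first by rewrite -val_eqE /= neq_ltn uv.
  by exists Q; rewrite ?uQ.
have lt1 : l - i < m by move: lt_m il lj; clear; lia.
have lt2 : j - l < m by move: lt_m il lj; clear; lia.
rewrite (IH l j lt2 (comp _ _ lQ jQ lj) lj) (IH i l lt1 (comp _ _ iQ lQ il) il).
have := ori Q QP i l j iQ lQ jQ il lj; rewrite (area_split QP iQ lQ jQ il lj).
clear; lia.
Qed.

Lemma sigma_oriented_exists : exists s, [/\ uniq s, forall i, i \in s &
  sigma_oriented s].
Proof.
have [s [us sT o]] := oriented_word_exists (fun Q =>
  Q \in black sigma) (black_white_subdivision sigma).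
exists s; split=> // [i|Q /o[r]]; first by rewrite sT in_setT.
exact: oriented_subseq.
Qed.

(** The step from [last] to [first] closes the walk; together with the step from [first] to [last]
    it makes one full turn, which is the 1 added to the total area. *)
Lemma card_cdes s (first last : 'I_n) : uniq s -> (forall i, i \in s) ->
    sigma_oriented s -> first = 0 :> nat -> last.+1 = n ->
  #|cdes s| = (\sum_(B in black sigma) (#|B| - 2)).+1.
Proof.
move=> us sT ori e0 en; have n3 := n_gt2 sigma.
have sl : ordS last = first by apply: val_inj; rewrite /= en modnn e0.
have -> : #|cdes s| = ndesc s last.+1.
  rewrite /ndesc -sum1_card big_mkcond [RHS]big_mkcond; apply: eq_bigr => l _.
  by rewrite en ltn_ord inE /turn; case: ifP.
have c0 := compatible_ends sigma e0 en.
have lt : first < last by rewrite e0; move: en n3; clear; lia.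
rewrite ndescS (ndesc_area ori c0 lt) area_ends // sl.
have -> : ndesc s first = 0 by rewrite /ndesc big_pred0 // => l; rewrite e0.
by rewrite add0n -addnA turn_compl ?addn1 //; case: c0.
Qed.

End Descents.

(** * Simplices and tiles *)

From mathcomp Require Import classical_sets reals ring lra.

Import Order.TTheory GRing.Theory Num.Theory.

Local Open Scope ring_scope.

Section Words.
Variables (n : nat) (w : 'S_n).

Lemma index_word i : index (w i) (word w) = i.
Proof. by rewrite index_map ?index_enum_ord //; apply: perm_inj. Qed.

Lemma big_index_word (V : nmodType) (p : pred nat) (F : nat -> V) :
  \sum_(a | p (index a (word w))) F (index a (word w)) = \sum_(m < n | p m) F m.
Proof.
rewrite (reindex_inj (@perm_inj _ w)) /=.
by apply: eq_big => [m|m _]; rewrite index_word.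
Qed.

Lemma in_cdes_rot_end (R : pzRingType) (a i : 'I_n) :
  (i \in cdes (rot_end (word w) a))%:R =
  (turn (word w) i (ordS i))%:R + (index i (word w) <= index a (word w))%N%:R
    - (index (ordS i) (word w) <= index a (word w))%N%:R :> R.
Proof.
have := turn_rot (index a (word w)).+1 (word_uniq w) (mem_word w i) (mem_word w (ordS
  i)).
rewrite !in_take ?mem_word // !ltnS => /(congr1 (fun m => m%:R : R)).
by rewrite !natrD /rot_end inE => <-; rewrite addrK.
Qed.

End Words.

Lemma word_surj n (s : seq 'I_n) : uniq s -> size s = n -> exists w : 'S_n, word w = s.
Proof.
case: n s => [|n] s us sz; first by exists 1%g; case: s us sz => [|[]];
  rewrite // /word enum_ord0.
have inj : injective (fun m : 'I_n.+1 => nth ord0 s m).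
  by move=> m m' /eqP; rewrite nth_uniq ?sz // => /eqP/val_inj.
exists (perm inj); apply: (@eq_from_nth _ ord0);
  first by rewrite size_map size_enum_ord.
move=> m; rewrite size_map size_enum_ord => lt_m.
by rewrite (nth_map ord0) ?size_enum_ord // permE nth_enum_ord.
Qed.

(** * Points of a simplex as positions on a circle *)

Section Simplices.
Variables (R : realType) (n : nat) (w : 'S_n).
Implicit Types (i j a : 'I_n) (c f : 'I_n -> R).

(** With the barycentric coordinates c as gaps on a circle of length 1, this is the distance from
    the point i to the end of the word. *)
Definition tail c i : R := \sum_(a | (index i (word w) <= index a (word w))%N) c a.

Lemma wsimplex_coord c i : \sum_a c a = 1 ->
  (\sum_a c a *: evec R (cdes (rot_end (word w) a))) ord0 i =
  (turn (word w) i (ordS i))%:R + tail c i - tail c (ordS i).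
Proof.
move=> c1; rewrite summxE /tail [X in _ + X - _]big_mkcond [X in _ - X]big_mkcond /=.
rewrite -[X in X + _ - _]mul1r -c1 mulr_suml -big_split -sumrB /=.
apply: eq_bigr => a _; rewrite !mxE in_cdes_rot_end mulrBr mulrDr c1.
by case: (index i _ <= _)%N; case: (index (ordS i) _ <= _)%N; rewrite /= ?mulr1 ?mulr0.
Qed.

(** The heights f are positions on the circle. The gaps between consecutive letters are nonnegative
    by the last two hypotheses and serve as barycentric coordinates. *)
Lemma wsimplex_of_heights (x : 'rV[R]_n) f (o : 'I_n) :
    (forall i, x ord0 i = (turn (word w) i (ordS i))%:R + f (ordS i) - f i) ->
    (forall i j, (index i (word w) <= index j (word w))%N -> f i <= f j) ->
    (forall i j, f j <= f i + 1) ->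
  wsimplex R w x.
Proof.
move=> xE fmono frange.
pose first := nth o (word w) 0.
(* At n the first letter returns one full turn later, so that the last gap closes the circle and the
   gaps add up to 1. *)
pose F m := if (m < n)%N then f (nth o (word w) m) else f first + 1.
have FE i : F (index i (word w)) = f i.
  have := mem_word w i; rewrite /F -index_mem size_map size_enum_ord => ->.
  by rewrite nth_index ?mem_word.
have sz : size (word w) = n by rewrite size_map size_enum_ord.
have Fn : F n = f first + 1 by rewrite /F ltnn.
have lt_index i : (index i (word w) < n)%N.
  by rewrite -[X in (_ < X)%N]sz index_mem mem_word.
have Fmono m : (m < n)%N -> F m <= F m.+1.
  move=> lt_m; rewrite /F lt_m; case: ltnP => // lt_m'.
  by apply: fmono; rewrite !index_uniq ?sz ?word_uniq.
pose c a := F (index a (word w)).+1 - F (index a (word w)).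
have tailE i : tail c i = f first + 1 - f i.
  rewrite /tail (@big_index_word _ w _ (fun m => index i (word w) <= m)%N
    (fun m => F m.+1 - F m)).
  have lt_i := lt_index i.
  have := telescope_sumr F (ltnW lt_i); rewrite FE Fn => <-.
  rewrite -(big_mkord (fun m => index i (word w) <= m)%N (fun m => F m.+1 - F m)).
  rewrite (big_cat_nat (leq0n (index i (word w))) (ltnW lt_i)) /=.
  rewrite big_nat_cond big1 ?add0r => [|m h]; last by exfalso; move: h; clear; lia.
  by rewrite big_nat_cond [RHS]big_nat_cond; apply: eq_bigl => m; clear; lia.
have first0 : index first (word w) = 0%N.
  by rewrite index_uniq ?word_uniq // sz; apply: leq_ltn_trans (ltn_ord o).
have c1 : \sum_a c a = 1.
  have := tailE first; rewrite /tail first0 [LHS](eq_bigl xpredT) // => ->.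
  by rewrite addrAC subrr add0r.
exists c; split=> // [a|].
  by rewrite subr_ge0 Fmono.
apply/rowP=> i; rewrite wsimplex_coord // xE !tailE; lra.
Qed.

End Simplices.

(** * Partial sums and arc sums of coordinates *)

Section PartialSums.
Variables (R : realType) (n : nat).
Implicit Types (i j l : 'I_n) (x : 'rV[R]_n).

Definition psum x (m : nat) : R := \sum_(l < n | (l < m)%N) x ord0 l.

Lemma psumS x i : psum x i.+1 = psum x i + x ord0 i.
Proof.
rewrite /psum (bigD1 i) ?ltnSn //= addrC; congr (_ + _).
by apply: eq_bigl => l; rewrite ltnS -val_eqE /= (ltn_neqAle l) andbC.
Qed.

Lemma psum0 x : psum x 0 = 0.
Proof. by rewrite /psum big_pred0. Qed.

Lemma psumn x : psum x n = \sum_(l < n) x ord0 l.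
Proof. by apply: eq_bigl => l; rewrite ltn_ord. Qed.

Lemma val_ord_pred j : ord_pred j = (if j == 0%N :> nat then n.-1 else j.-1) :> nat.
Proof.
have := ltn_ord j; case: eqP => [e|e] lt_j /=.
  by rewrite e add0n modn_small //; lia.
by rewrite (_ : (j + n).-1 = j.-1 + n)%N ?modnDr ?modn_small //; lia.
Qed.

Lemma sum_arc x i j : i != j ->
  \sum_(l in cint i (ord_pred j)) x ord0 l =
  psum x j - psum x i + (if (i < j)%N then 0 else psum x n).
Proof.
move=> ij.
have E (u v : 'I_n) : (u < v)%N ->
    psum x v = psum x u + \sum_(l < n | (u <= l < v)%N) x ord0 l.
  move=> uv; rewrite /psum (bigID (fun l : 'I_n => (l < u)%N)) /=.
  by congr (_ + _); apply: eq_bigl => l; lia.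
have jn := ltn_ord j.
case: ltnP => [lt_ij|le_ji].
  rewrite (E _ _ lt_ij) addr0 addrC addKr; apply: eq_bigl => l.
  by rewrite in_cint val_ord_pred; case: eqP => [|] e; case: ifP; lia.
have lt_ji : (j < i)%N by rewrite ltn_neqAle le_ji andbT eq_sym -val_eqE in ij *.
rewrite (E _ _ lt_ji) psumn opprD addrA subrr sub0r addrC.
rewrite [X in X - _](bigID (fun l : 'I_n => (j <= l < i)%N)) /= addrAC subrr add0r.
apply: eq_bigl => l; have lt_l := ltn_ord l; have lt_i := ltn_ord i.
rewrite in_cint val_ord_pred; case: eqP => e.
  by rewrite (_ : (i <= n.-1)%N = true); move: e lt_ji lt_l lt_i; clear; lia.
by rewrite (_ : (i <= j.-1)%N = false); move: e lt_ji lt_l lt_i; clear; lia.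
Qed.

Lemma psum_heights x (s : seq 'I_n) (g : 'I_n -> R) (o i : 'I_n) : o = 0%N :> nat ->
    (forall i, x ord0 i = (turn s i (ordS i))%:R + g i - g (ordS i)) ->
  psum x i = (ndesc s i)%:R + g o - g i.
Proof.
move=> o0 xE; case: i => m lt_m /=; elim: m lt_m => [|m IH] lt_m.
  rewrite psum0 /ndesc big_pred0 //.
  by rewrite (_ : Ordinal lt_m = o) ?addrK ?add0r ?subrr //; apply: val_inj.
have lt_m' := ltnW lt_m; have := IH lt_m'.
have := psumS x (Ordinal lt_m'); have := ndescS s (Ordinal lt_m'); rewrite /= => -> ->.
rewrite xE (_ : ordS (Ordinal lt_m') = Ordinal lt_m) ?natrD; last exact: val_ordS.
move=> ->; lra.
Qed.

End PartialSums.

(* [y] is the excess of an arc sum over the area, and [f], [d] are the rounded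
   part and the tie-breaking perturbation of the two end points. *)
Lemma excess_int (R : realType) (y fi fj di dj : R) (D : int) :
    D%:~R = y - (fj - fi) -> 0 <= y <= 1 ->
    (y = 0 -> di < dj) -> (y = 1 -> dj < di) ->
    -1 <= fi <= 0 -> -1 <= fj <= 0 -> (fj = 0 -> dj <= 0) -> (fi = -1 -> 0 < di) ->
    (fi < fj) || (fi == fj) && (di <= dj) -> D = 0.
Proof.
move=> DE /andP[y0 y1] h0 h1 /andP[fi0 fi1] /andP[fj0 fj1] hj hi hij.
(* As D is an integer, -1 < D < 1 suffices; the extreme values of y that would reach these bounds
   contradict the conditions on [di] and [dj]. *)
have lt1 : D%:~R < 1 :> R.
  rewrite DE; case/orP: hij => [|/andP[/eqP -> dij]]; first by lra.
  have : y != 1 by apply/eqP=> /h1; lra.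
  by rewrite neq_lt => /orP[]; lra.
have gtm1 : -1 < D%:~R :> R.
  rewrite DE; case/orP: hij => [fij|/andP[/eqP -> dij]]; last by lra.
  have [e|] := eqVneq y 0; last by rewrite neq_lt => /orP[]; lra.
  have := h0 e; have [ej|] := eqVneq fj 0; last by rewrite neq_lt => /orP[]; lra.
  have [ei|] := eqVneq fi (-1); last by rewrite neq_lt => /orP[]; lra.
  by have := hj ej; have := hi ei; lra.
move: lt1 gtm1; rewrite -[1]/(1%:~R) -[-1]/((-1)%:~R) !ltr_int.
by clear; lia.
Qed.

(** * The two inclusions *)

Section Tile.
Variables (R : realType) (n k : nat) (sigma : bicolored_subdivision n).
Hypothesis hk : has_type sigma k.
Implicit Types (i j l : 'I_n) (x : 'rV[R]_n).

Lemma compatible_sym i j : compatible sigma i j -> compatible sigma j i.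
Proof. by case=> ij [Q QP h]; split; [rewrite eq_sym|exists Q; rewrite // andbC]. Qed.

(** Arcs with i < j suffice: sums over complementary arcs add up to k + 1 and their areas to k, so
    the bounds for an arc are those for its complement. *)
Lemma tile_bounds x : \sum_(i < n) x ord0 i = k.+1%:R ->
  (forall i j, compatible sigma i j -> (i < j)%N ->
     (area sigma i j)%:R <= psum x j - psum x i <= (area sigma i j)%:R + 1) <->
  Gamma R sigma k x.
Proof.
move=> xk; split=> [bd|[_ G] i j cij ij].
  split=> // i j a cij /(has_areaP _ cij) ->; have [ij _] := cij.
  rewrite sum_arc //; case: ltnP => [lt_ij|le_ji]; first by rewrite addr0 bd.
  have lt_ji : (j < i)%N by rewrite ltn_neqAle le_ji andbT eq_sym -val_eqE in ij *.
  have := bd _ _ (compatible_sym cij) lt_ji.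
  have := area_compl cij; rewrite -(type_sum hk) => /(congr1 (fun m => m%:R : R)).
  rewrite natrD psumn xk -natr1; lra.
have := G i j _ cij (proj2 (has_areaP _ cij) erefl).
by rewrite sum_arc ?ij ?addr0 //; case: cij.
Qed.

(** By [ndesc_area] an arc sum exceeds the area by [turn s i j] + G i - G j, a clockwise distance on
    the circle of length 1, which lies in [0, 1]. *)
Lemma simplex_in_tile (w : 'S_n) x : sigma_oriented sigma (word w) ->
  #|cdes (word w)| = k.+1 -> wsimplex R w x -> Gamma R sigma k x.
Proof.
move=> ori cd [c [c0 c1 xE]]; set s := word w in ori cd *.
pose G := tail w c.
have xi i : x ord0 i = (turn s i (ordS i))%:R + G i - G (ordS i).
  by rewrite xE wsimplex_coord.
have tot : \sum_(i < n) x ord0 i = k.+1%:R.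
  rewrite (eq_bigr _ (fun i _ => xi i)) sumrB big_split /=.
  rewrite [X in _ + X - _](reindex_inj (@ordS_inj n)) /= addrK -cd -natr_sum.
  congr (_%:R); rewrite -sum1_card [RHS]big_mkcond; apply: eq_bigr => i _.
  by rewrite inE /turn; case: ifP.
apply/(tile_bounds tot) => i j cij ij.
have n0 : (0 < n)%N by apply: leq_ltn_trans (ltn_ord i).
pose o := Ordinal n0.
rewrite !(psum_heights (o := o) _ _ xi) //.
have G0 u : 0 <= G u by apply: sumr_ge0.
have G1 u : G u <= 1.
  by rewrite -c1 /G /tail big_mkcond; apply: ler_sum => a _; case: ifP.
have Gmono u v : (index u s <= index v s)%N -> G v <= G u.
  move=> uv; rewrite /G /tail big_mkcond [X in _ <= X]big_mkcond.
  apply: ler_sum => a _; case: ifP => [va|_]; last by case: ifP.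
  by rewrite (leq_trans uv va).
have := ndesc_area ori cij ij => /(congr1 (fun m => m%:R : R)); rewrite !natrD.
have := G0 i; have := G0 j; have := G1 i; have := G1 j.
case: (boolP (turn s i j)) => [t|].
  by have := Gmono j i (ltnW t) => /=; lra.
by rewrite /turn -leqNgt => /Gmono /=; lra.
Qed.

(* The barycentre of the simplex of a word oriented as sigma. *)
Lemma interior_heights : exists z : 'I_n -> R, forall i j,
  compatible sigma i j -> (i < j)%N ->
  (area sigma i j)%:R < z j - z i < (area sigma i j)%:R + 1.
Proof.
have [s [us sT ori]] := sigma_oriented_exists sigma.
have n0 : 0 < n%:R :> R by rewrite ltr0n; have := n_gt2 sigma; case: n.
exists (fun i => (ndesc s i)%:R + (index i s)%:R / n%:R) => i j cij ij.
have := ndesc_area ori cij ij => /(congr1 (fun m => m%:R : R)); rewrite !natrD => ->.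
have pos u : 0 <= (index u s)%:R / n%:R :> R by rewrite divr_ge0.
have lt1 u : (index u s)%:R / n%:R < 1 :> R.
  rewrite ltr_pdivrMr // mul1r ltr_nat.
  have szs : size s = n.
    by rewrite -(card_uniqP us) -[RHS]card_ord; apply: eq_card => u'; rewrite sT.
  by rewrite -[X in (_ < X)%N]szs index_mem.
have lt_idx u v : (index u s < index v s)%N ->
    (index u s)%:R / n%:R < (index v s)%:R / n%:R :> R.
  by move=> uv; rewrite ltr_pM2r ?invr_gt0 // ltr_nat.
have := turn_compl (proj1 cij) (sT i) (sT j).
have := pos i; have := pos j; have := lt1 i; have := lt1 j.
case: (boolP (turn s i j)) => [/lt_idx|_] /=; first by lra.
by case: (boolP (turn s j i)) => [/lt_idx /=|//]; lra.
Qed.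

(** Letters are sorted by the fractional parts of the partial sums, and ties by the direction to an
    interior point of the tile, as if x were moved slightly inwards. The integer parts then count
    full turns, and comparing them with areas gives the orientation. *)
Lemma tile_in_simplices x : Gamma R sigma k x ->
  exists w : 'S_n, [/\ Dset k.+1 w, sigma_oriented sigma (word w) & wsimplex R w x].
Proof.
move=> Gx; have [xk _] := Gx; have bd := proj2 (tile_bounds xk) Gx.
have [z0 z0P] := interior_heights.
have n3 := n_gt2 sigma.
have lt_last : (n.-1 < n)%N by move: n3; clear; lia.
pose last := Ordinal lt_last; have elast : last.+1 = n :> nat by move: n3;
  clear=> /=; lia.
pose o : 'I_n := Ordinal (ltn_trans (isT : 0 < 2)%N n3).
(* Heights vanish at [last], so that this letter can end the word. [d] is the velocity of the
   heights towards the interior point. *)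
pose z i := psum x i - psum x last.
pose d i := z0 i - z0 last - z i.
(* z - m is to be the fractional part in (-1, 0] of z moved slightly in direction d, in the limit:
   an integral height leaves 0 if d <= 0 and -1 if d > 0. *)
have : forall i, exists m : int, [/\ -1 <= z i - m%:~R <= 0,
    z i - m%:~R = 0 -> d i <= 0 & z i - m%:~R = -1 -> 0 < d i].
  move=> i; have /andP[lt ge] := ceil_itv (z i); rewrite intrB in lt.
  have [/andP[/eqP e d0]|h] := boolP ((z i == (Num.ceil (z i))%:~R) && (0 < d i)).
    by exists (Num.ceil (z i) + 1); rewrite intrD -e; split=> //; lra.
  exists (Num.ceil (z i)); split; [by lra|move=> e0|by lra].
  by move: h; rewrite (_ : z i == _) ?leNgt //; apply/eqP; lra.
case/choice=> M MP; pose f i := z i - (M i)%:~R.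
have zlast : z last = 0 by rewrite /z subrr.
have dlast : d last = 0 by rewrite /d zlast subrr subr0.
have f0 i : -1 <= f i <= 0 by case: (MP i).
have fd0 i : f i = 0 -> d i <= 0 by case: (MP i).
have fd1 i : f i = -1 -> 0 < d i by case: (MP i).
have flast : f last = 0.
  have [m1|nm1] := eqVneq (f last) (-1); first by have := fd1 _ m1; rewrite dlast ltxx.
  have : -1 < f last by rewrite lt_neqAle eq_sym nm1; case/andP: (f0 last).
  case/andP: (f0 last) => _; rewrite /f zlast sub0r => h1 h2.
  have : (M last < 1)%R by rewrite -(ltr_int R); lra.
  have : (0 <= M last)%R by rewrite -(ler_int R); lra.
  move=> h3 h4; have -> : M last = 0 by move: h3 h4; clear; lia.
  exact: oppr0.
pose le i j := (f i < f j) || (f i == f j) && (d i <= d j).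
have le_tot : total le.
  by move=> i j; rewrite /le; case: ltgtP => //= _; rewrite le_total.
have le_tr : transitive le.
  move=> j i l; rewrite /le => /orP[h1|/andP[/eqP e1 h1]] /orP[h2|/andP[/eqP e2 h2]].
  - by rewrite (lt_trans h1 h2).
  - by rewrite -e2 h1.
  - by rewrite e1 h2.
  - by rewrite e1 e2 eqxx (le_trans h1 h2) orbT.
(* [last] is maximal for [le], having f = 0 and d = 0, so appending it keeps the word sorted. *)
pose s := rcons (sort le (enum [set~ last])) last.
have sT i : i \in s.
  by rewrite mem_rcons inE mem_sort mem_enum !inE; case: eqP.
have us : uniq s.
  by rewrite rcons_uniq sort_uniq enum_uniq mem_sort mem_enum !inE eqxx.
have srt : sorted le s.
  rewrite (sorted_pairwise le_tr) pairwise_rcons -(sorted_pairwise le_tr) sort_sorted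
    // andbT.
  apply/allP=> i _; rewrite /le flast dlast; have /andP[_] := f0 i.
  by rewrite le_eqVlt => /orP[/eqP h|->//]; rewrite h ltxx eqxx fd0.
have idx_le i j : (index i s < index j s)%N -> le i j.
  exact: (sorted_ltn_index le_tr srt).
have key i j : compatible sigma i j -> (i < j)%N ->
    M j - M i = (area sigma i j + turn s i j)%N.
  move=> cij ij; have [nij _] := cij.
  have := bd _ _ cij ij; have := z0P _ _ cij ij => z0ij zij.
  pose y := z j - z i - (area sigma i j)%:R.
  pose D := M j - M i - (area sigma i j)%:Z.
  have DE : D%:~R = y - (f j - f i).
    rewrite /D !intrB /y /f pmulrn; ring.
  have y01 : 0 <= y <= 1 by rewrite /y /z; lra.
  have y0 : y = 0 -> d i < d j by rewrite /y /d; lra.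
  have y1 : y = 1 -> d j < d i by rewrite /y /d; lra.
  suff : D = turn s i j by rewrite /D; clear; lia.
  have := turn_compl nij (sT i) (sT j).
  (* If j precedes i in s, reflect: y becomes 1 - y, and i and j change places. *)
  case: (boolP (turn s i j)) => [/idx_le leji _|_].
    suff : 1 - D = 0 by clear=> /=; lia.
    apply: (@excess_int R (1 - y) (f j) (f i) (d j) (d i)) => //.
    - by rewrite intrB DE; ring.
    - by lra.
    - by move=> h; apply: y1; lra.
    - by move=> h; apply: y0; lra.
    - exact: fd0.
    - exact: fd1.
  case: (boolP (turn s j i)) => [/idx_le leij _|//].
  apply: (@excess_int R y (f i) (f j) (d i) (d j)) => //; [exact: fd0|exact: fd1].
have szs : size s = n.
  by rewrite -(card_uniqP us) -[RHS]card_ord; apply: eq_card => i; rewrite sT.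
have [w ws] := word_surj us szs.
have ori : sigma_oriented sigma (word w).
  rewrite ws => Q QP i l j iQ lQ jQ il lj.
  have comp (u v : 'I_n) : u \in Q -> v \in Q -> (u < v)%N -> compatible sigma u v.
    move=> uQ vQ uv; split; first by rewrite -val_eqE /= neq_ltn uv.
    by exists Q; rewrite ?uQ.
  have ij := ltn_trans il lj.
  (* Differences of M are additive, so [turn] fails to be additive by the same amount as [area],
     which is the colour of Q. *)
  have := key _ _ (comp _ _ iQ lQ il) il; have := key _ _ (comp _ _ lQ jQ lj) lj.
  have := key _ _ (comp _ _ iQ jQ ij) ij; rewrite (area_split QP iQ lQ jQ il lj).
  clear; lia.
exists w; split=> //.
  split=> [i ei|]; last first.
    by rewrite (card_cdes (first := o) (last :=
      last) (word_uniq w) (mem_word w) ori) // -(type_sum hk).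
  have vi : i = n.-1 :> nat by move: ei; clear; lia.
  have ei' : i = last by apply: val_inj.
  have : nth last (word w) i = w i.
    by rewrite (nth_map i) ?size_enum_ord // nth_ord_enum.
  rewrite ws nth_rcons size_sort -cardE cardsC1 card_ord vi ltnn eqxx.
  by move=> <-; rewrite ei'.
apply: (@wsimplex_of_heights R n w x f o).
(* The step from n-1 back to 0 wraps around; its coordinate is recovered from the arc from 0 to n-1,
   of area k, and the total k + 1. *)
- rewrite ws => i; have [e|ne] := eqVneq i last.
    have lt : (o < last)%N by have := n3; clear=> /=; lia.
    have c0 := compatible_ends sigma (erefl : o = 0%N :> nat) elast.
    have -> : ordS i = o by apply: val_inj; rewrite /= e elast modnn.
    have := key _ _ c0 lt; rewrite area_ends // -(type_sum hk).
    have := turn_compl (proj1 c0) (sT o) (sT last).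
    move=> /(congr1 (fun m => m%:R : R)); rewrite natrD => tc.
    move=> /(congr1 (fun m => m%:~R : R)); rewrite intrB -pmulrn natrD => kc.
    have := psumS x last; rewrite elast psumn xk -natr1.
    by rewrite e /f /z psum0; lra.
  have lt : (i.+1 < n)%N.
    have := ltn_ord i; move: ne; rewrite -val_eqE /=; clear; lia.
  have e : Ordinal lt = i.+1 :> nat by [].
  have ci := compatible_consecutive sigma e.
  have := key _ _ ci (ltnSn i); rewrite area_consecutive // add0n (val_ordS e).
  move=> /(congr1 (fun m => m%:~R : R)); rewrite intrB -pmulrn => kc.
  by have := psumS x i; rewrite /f /z /=; lra.
- rewrite ws => i j; rewrite leq_eqVlt =>
  /orP[/eqP e|/idx_le /orP[/ltW//|/andP[/eqP-> _]//]].
  by have -> : i = j by rewrite -(nth_index i (sT i)) -(nth_index i (sT j)) e.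
- by move=> i j; have /andP[h1 h2] := f0 i; have /andP[h3 h4] := f0 j; lra.
Qed.

End Tile.

Local Open Scope classical_set_scope.

Theorem theorem3p1 (R : realType) (n k : nat) (sigma : bicolored_subdivision n)
    (hk : has_type sigma k) :
  Gamma R sigma k =
  \bigcup_(w in [set w : 'S_n | [/\ Dset k.+1 w,
      forall Q : {set 'I_n}, Q \in white sigma -> in_cyclic_order (enum Q) w
    & forall Q : {set 'I_n}, Q \in black sigma ->
        in_cyclic_order (rev (enum Q)) w]])
    wsimplex R w.
Proof.
apply/seteqP; split=> [x Gx|x [w [[_ cd] hw hb] xw]].
  have [w [Dw ori xw]] := tile_in_simplices hk Gx; exists w => //; split=> // Q hQ.
    apply/(@oriented_in_cyclic_order n w Q false).
    have := ori Q; rewrite finset.in_setU hQ orbT => /(_ isT).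
    have := black_white_disjoint sigma; rewrite disjoint_sym => /disjointFr/(_ hQ) ->.
    by [].
  apply/(@oriented_in_cyclic_order n w Q true).
  by have := ori Q; rewrite finset.in_setU hQ => /(_ isT).
apply: (simplex_in_tile hk _ cd xw) => Q.
rewrite finset.in_setU; case: (boolP (Q \in black sigma)) => [bQ _|_ /= wQ].
  exact/oriented_in_cyclic_order/hb.
exact/oriented_in_cyclic_order/hw.
Qed.
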